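(* Let $\kappa\in{\mathbb Z}_{>0}\cup\{\infty\}$ with $\kappa\geq 2$. There exists $\delta=\delta(\kappa)\in(0,1)$ such that the following holds. Let $R\in{\mathbb Z}_{\geq 0}^m$, $C\in{\mathbb Z}_{\geq 0}^n$ with $|R|=|C|=N$ and $T_\kappa(R,C)>0$, and suppose $$\Big(\max_{1\leq i\leq m} r_i\Big)\Big(\max_{1\leq j\leq n} c_j\Big) \;<\; \delta\kappa N .$$ Then $$\lim_{s\rightarrow\infty} \frac{1}{s^2} \ln T_\kappa(R^{(s)},C^{(s)}) \;\geq\; \lim_{s\rightarrow\infty} \frac{1}{s^2} \ln I_\kappa(R^{(s)},C^{(s)}),$$ with strict inequality if neither $R$ nor $C$ is a constant vector (i.e. it is not the case that $r_1=\cdots=r_m$, and it is not the case that $c_1=\cdots=c_n$).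
   Context: $|V|$ is the sum of entries of $V$. For $R\in{\mathbb Z}_{\geq 0}^m$, $C\in{\mathbb Z}_{\geq 0}^n$ and $\kappa\in{\mathbb Z}_{>0}\cup\{\infty\}$, $T_\kappa(R,C)$ is the number of $m\times n$ matrices with entries in $\{0,1,\ldots,\kappa\}$ ($={\mathbb Z}_{\geq 0}$ if $\kappa=\infty$) with row sums $r_i$ and column sums $c_j$ (same definition for any dimensions). Cloning: $R^{(s)}\in{\mathbb Z}^{sm}$ consists of $s$ consecutive copies of $(sr_1,\ldots,sr_m)$ and $C^{(s)}\in{\mathbb Z}^{sn}$ of $s$ copies of $(sc_1,\ldots,sc_n)$. $(\kappa+1)$-nomial coefficients: ${n\choose r}_\kappa$ is the coefficient of $x^r$ in $(1+x+\cdots+x^\kappa)^n$ (in $(1+x+x^2+\cdots)^n$ if $\kappa=\infty$). Independence estimate: $I_\kappa(R,C):={mn\choose N}_\kappa^{-1}\prod_{i=1}^m{n\choose r_i}_\kappa\prod_{j=1}^n{m\choose c_j}_\kappa$ with $N=|R|=|C|$ (same for any dimensions). Both limits exist under the hypotheses. When $\kappa=\infty$, $\delta\kappa N$ is interpreted as $+\infty$. *)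

(* Defs.v *)
From mathcomp Require Import all_boot all_order all_algebra finmap.
From mathcomp Require Import all_classical all_reals all_analysis.
Set Implicit Arguments.
Unset Strict Implicit.
Unset Printing Implicit Defensive.
Import Order.TTheory GRing.Theory Num.Theory.

Local Open Scope classical_set_scope.

(* [Some k] is the finite bound k, [None] is the absence of a bound
   (kappa = infinity). *)
Definition entry_bound := option nat.

Definition leq_entry_bound (x : nat) (kappa : entry_bound) : bool :=
  if kappa is Some k then (x <= k)%N else true.

(* Vectors of nonnegative integers are sequences; the margins R and C carry
   the dimensions [size R] and [size C] of the matrix. *)
Definition transport_matrices (kappa : entry_bound) (R C : seq nat) :
    set 'M[nat]_(size R, size C) :=
  [set V : 'M[nat]_(size R, size C) |
    [/\ forall i j, leq_entry_bound (V i j) kappa,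
        forall i, (\sum_(j < size C) V i j)%N = nth 0%N R i &
        forall j, (\sum_(i < size R) V i j)%N = nth 0%N C j]].
Arguments transport_matrices : clear implicits.

(* [fset_set] is the empty set on infinite sets; this shows that
   [num_transport] below is a true count, including for kappa = infinity. *)
Lemma finite_transport_matrices kappa R C :
  finite_set (transport_matrices kappa R C).
Proof.
pose f (W : 'M['I_(sumn R).+1]_(size R, size C)) : 'M[nat]_(_, _) :=
  map_mx (@nat_of_ord _) W.
apply: (@sub_finite_set _ _ (f @` setT)); last first.
  exact/finite_image/finite_finset.
move=> V [_ rV _]; exists (map_mx (@inord (sumn R)) V) => //.
apply/matrixP => i j; rewrite !mxE inordK// ltnS.
apply: (@leq_trans (nth 0%N R i)).
  by rewrite -rV (bigD1 j)//= leq_addr.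
rewrite sumnE (big_nth 0%N) big_mkord (bigD1 i)//=; exact: leq_addr.
Qed.

Definition num_transport (kappa : entry_bound) (R C : seq nat) : nat :=
  #|` fset_set (transport_matrices kappa R C)|%fset.

Definition clone (s : nat) (R : seq nat) : seq nat :=
  flatten (nseq s [seq (s * r)%N | r <- R]).

(* Formal power series over nat, given by their coefficients. *)
Definition fps := nat -> nat.
Definition fps_one : fps := fun r => nat_of_bool (r == 0%N).
Definition fps_mul (f g : fps) : fps :=
  fun r => (\sum_(i < r.+1) f i * g (r - i))%N.
Definition fps_exp (f : fps) (n : nat) : fps := iter n (fps_mul f) fps_one.
Definition fps_geom : fps := fun=> 1%N.

Definition nomial (kappa : entry_bound) (n r : nat) : nat :=
  match kappa with
  | Some k => (((\sum_(i < k.+1) 'X^i : {poly nat}) ^+ n)`_r)%R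
  | None => fps_exp fps_geom n r
  end.

Local Open Scope ring_scope.

Definition indep_estimate (K : realType) (kappa : entry_bound)
    (R C : seq nat) : K :=
  (nomial kappa (size R * size C) (sumn R))%:R^-1
  * (\prod_(r <- R) (nomial kappa (size C) r)%:R)
  * (\prod_(c <- C) (nomial kappa (size R) c)%:R).

(* The convention delta * oo * N = +oo is used also when N = 0, where the
   product of extended reals would be 0. *)
Definition sparsity_threshold (K : realType) (delta : K)
    (kappa : entry_bound) (N : nat) : \bar K :=
  if kappa is Some k then (delta * k%:R * N%:R)%:E else +oo%E.

Definition log_transport (K : realType) (kappa : entry_bound)
    (R C : seq nat) (s : nat) : K :=
  (s%:R ^+ 2)^-1 * ln (num_transport kappa (clone s R) (clone s C))%:R.

Definition log_indep (K : realType) (kappa : entry_bound)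
    (R C : seq nat) (s : nat) : K :=
  (s%:R ^+ 2)^-1 * ln (indep_estimate K kappa (clone s R) (clone s C)).

(* Main.v *)
Require Import Defs.
From mathcomp Require Import all_boot all_order all_algebra finmap.
From mathcomp Require Import all_classical all_reals all_analysis.
From mathcomp Require Import zify ring lra.
Import Order.TTheory GRing.Theory Num.Theory.
Import numFieldNormedType.Exports.
Set Implicit Arguments.
Unset Strict Implicit.
Unset Printing Implicit Defensive.

(* The exponential growth rate of [nomial kappa n (n y)] is the entropy
   [g y = min_t (ln Z t - y ln t)], where [Z] is the generating function of the
   allowed entries, so the independence side has the explicit limit
   [n sum_i g (r_i / n) + m sum_j g (c_j / m) - m n g (N / (m n))].
   On the other side, ln T / s^2 converges to its supremum because blocks can be
   put side by side, and this supremum is at least [sum_ij g (r_i c_j / N)]: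
   fill the block [(i, j)] of the clone of order [s^2] with a matrix all of whose
   line sums are [s^2 r_i c_j / N].  Such matrices are numerous enough since, by
   pigeonhole, some margin carries an exp(-o(s^2)) fraction of all matrices with
   a given total, and putting all cyclic shifts of that margin in a square of
   blocks makes the line sums constant.
   The two exponents are compared by applying Jensen's inequality twice; this
   works where [y^2 g'' y] is strictly convex, that is, near 0 if kappa is finite
   and at least 2, and everywhere if kappa is infinite. *)

(** The other arguments of [g], namely [r_i / n], [c_j / m] and [N / (m n)], are averages of the
    numbers [r_i c_j / N]. So the hypothesis on the two maxima keeps every argument inside an
    interval [[0, M[] on which [y^2 g''] is known to be strictly convex. For finite [kappa] such an
    [M] comes from continuity at 0: the sign that decides convexity there depends on the generating
    function only to second order, so it is the same for all [kappa >= 2] as for unbounded entries,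
    and it is the opposite one for entries in {0, 1}. The first Jensen is applied to [y^2 g''] at
    the points [a c_j] and shows that the difference between [sum_j g (a c_j)] and [n g (a N / n)]
    is convex in [a]. The second is applied to this difference at the points [a = r_i / N]. Margins
    may contain zeros and [g] has infinite slope at 0, so at 0 only continuity of [g] can be
    used. *)

Arguments nomial : simpl never.

(** * Bounds for the nomial coefficients *)

Section NomialBounds.
Local Open Scope ring_scope.

Lemma nomial0 kappa r : nomial kappa 0 r = (r == 0)%N.
Proof. by case: kappa => [k|]; rewrite /nomial //= expr0 coef1; case: eqP. Qed.

Lemma nomialS kappa n r : nomial kappa n.+1 r =
  (\sum_(j < r.+1 | leq_entry_bound j kappa) nomial kappa n (r - j))%N.
Proof.
case: kappa => [k|]; rewrite /nomial /=; last by apply: eq_bigr => i _; rewrite mul1n.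
rewrite exprS coefM [RHS]big_mkcond /=; apply: eq_bigr => j _.
have -> : (\sum_(i < k.+1) 'X^i : {poly nat})`_j = (j <= k)%N.
  have -> : \sum_(i < k.+1) 'X^i = \poly_(i < k.+1) (1%N : nat) :> {poly nat}.
    by rewrite poly_def; apply: eq_bigr => i _; rewrite scale1r.
  by rewrite coef_poly ltnS; case: ifP.
by case: ifP => _; [rewrite mul1r|rewrite mul0r].
Qed.

Lemma nomial_r0 kappa n : nomial kappa n 0 = 1%N.
Proof.
have k0 : leq_entry_bound 0%N kappa by case: kappa.
elim: n => [|n IH]; first by rewrite nomial0.
by rewrite nomialS big_mkcond big_ord1 /= IH k0.
Qed.

(* Log-concavity without internal zeros, in cross-multiplied form. *)
Definition log_concave (f : nat -> nat) :=
  forall i j, (i <= j)%N -> (f i * f j.+1 <= f i.+1 * f j)%N.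

(** Induction on [b - a], with [b <= c] by symmetry: each step passes from the pair [(b - 1, c + 1)]
    to [(b, c)]. No division occurs, so zeros of [f] do no harm. *)
Lemma log_concave_inward f a b c d : log_concave f ->
  (a <= b)%N -> (a <= c)%N -> (a + d = b + c)%N -> (f a * f d <= f b * f c)%N.
Proof.
move=> lcf; wlog bc : b c / (b <= c)%N.
  move=> H ab ac e; case: (leqP b c) => bc; first exact: H.
  by rewrite [leqRHS]mulnC; apply: H => //; lia.
move=> /subnK; move: (b - a)%N => e; elim: e b c d bc => [|e IH] b c d bc.
  by move=> <- _ /(@addnI a) ->.
move=> eb ac ed; have cE : c = c.+1.-1 by [].
apply: leq_trans (IH b.-1 c.+1 d _ _ _ _) _; [lia..|].
have -> : b = b.-1.+1 by lia.
by rewrite /=; apply: lcf; lia.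
Qed.

(** The window is multiplication by [1 + x + ... + x^k]. When both products are expanded, [Si * Sj]
    cancels and the three remaining pairs of terms are [h1], [h2] and [h3]. *)
Lemma log_concave_window f k : log_concave f ->
  log_concave (fun r => \sum_(j < r.+1 | (j <= k)%N) f (r - j))%N.
Proof.
move=> lcf.
(* A shift past the origin must count as 0, whereas [f (r - l)] with truncated subtraction would
   give [f 0]. *)
pose e l r := if (l <= r)%N then f (r - l)%N else 0%N.
have FE r : (\sum_(j < r.+1 | (j <= k)%N) f (r - j) = \sum_(l < k.+1) e l r)%N.
  rewrite big_mkcond (big_ord_widen_cond (maxn r.+1 k.+1)
    (fun _ => true) (fun j => if (j <= k)%N then f (r - j)%N else 0%N))
    ?leq_maxl//.
  rewrite (big_ord_widen_cond (maxn r.+1 k.+1) (fun _ => true) (fun l => e l r))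
    ?leq_maxr//.
  rewrite big_mkcond [RHS]big_mkcond; apply: eq_bigr => i _ /=; rewrite !ltnS /e.
  by case: (i <= k)%N; case: (i <= r)%N.
have ee l i j : (i <= j)%N -> (e l i * f j.+1 <= f i.+1 * e l j)%N.
  move=> ij; rewrite /e; case: (leqP l i) => li; last by rewrite mul0n.
  rewrite (leq_trans li ij); apply: log_concave_inward => //; lia.
move=> i j ij; rewrite !FE.
have FS r : (\sum_(l < k.+1) e l r.+1 = f r.+1 + \sum_(l < k) e l r)%N.
  by rewrite big_ord_recl /= {1}/e /= subn0.
rewrite !FS ![(\sum_(l < k.+1) _)%N]big_ord_recr /=.
set Si := (\sum_(_ < _) e _ i)%N; set Sj := (\sum_(_ < _) e _ j)%N.
have h1 : (Si * f j.+1 <= f i.+1 * Sj)%N.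
  by rewrite big_distrl big_distrr; apply: leq_sum => l _; exact: ee.
have h2 := ee k i j ij.
have h3 : (e k i * Sj <= Si * e k j)%N.
  rewrite big_distrl big_distrr; apply: leq_sum => -[l lk] _ /=.
  rewrite /e; case: (leqP k i) => ki; last by rewrite mul0n.
  rewrite !ifT ?(leq_trans _ ij)//; try lia.
  by apply: log_concave_inward => //; lia.
nia.
Qed.

Lemma log_concave_nomial k n : log_concave (nomial (Some k) n).
Proof.
elim: n => [|n IH] i j ij; first by rewrite !nomial0 /= muln0.
by rewrite !nomialS; exact: (@log_concave_window _ k IH i j ij).
Qed.

Lemma nomial_gt0 k n r : (r <= k * n)%N -> (0 < nomial (Some k) n r)%N.
Proof.
elim: n r => [|n IH] r rkn; first by rewrite nomial0; lia.
have mr : (minn r k < r.+1)%N by lia.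
rewrite nomialS (bigD1 (Ordinal mr)) /= ?geq_minr//.
by rewrite addn_gt0 IH//; lia.
Qed.

Lemma nomial1_bin n r : nomial (Some 1%N) n r = 'C(n, r).
Proof.
elim: n r => [|n IH] [|r]; rewrite ?nomial0 ?bin0 ?bin0n//.
  by rewrite nomialS big_mkcond big_ord1 /= IH bin0.
rewrite nomialS big_mkcond /= !big_ord_recl /= big1 ?addn0 //.
by rewrite !IH subn0 subSS subn0 binS.
Qed.

Lemma nomialoo_bin n r : nomial None n.+1 r = 'C(n + r, r).
Proof.
elim: n r => [|n IH] r.
  rewrite nomialS add0n binn (bigD1 ord_max) //= subnn nomial0 big1 ?addn0//.
  by move=> i /eqP/val_eqP /= ir; rewrite nomial0; case: i ir => /=; lia.
elim: r => [|r IHr].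
  by rewrite nomialS big_ord1 /= IH !addn0 !bin0.
rewrite nomialS /= big_ord_recl /= IH subn0.
have -> : (\sum_(i < r.+1) nomial None n.+1 (r.+1 - bump 0 i) =
           nomial None n.+2 r)%N.
  by rewrite nomialS; apply: eq_bigr => i _; rewrite subSS.
by rewrite IHr addSn !addnS binS addSn [RHS]binS [X in _ = (X + _)%N]binS.
Qed.

(** * Upper and lower bounds through the generating function *)

Section GeneratingFunction.
Variable K : realType.
Implicit Types (t y : K) (kappa : entry_bound).

(** For unbounded entries the closed form is the sum of the geometric series only for [t] below 1,
    hence the side condition [kappa = None -> t < 1] in later statements. *)
Definition gen kappa t : K :=
  if kappa is Some k then \sum_(i < k.+1) t ^+ i else (1 - t)^-1.

(* Mean of the distribution with weights [t ^+ i] on the allowed entries [i]. *)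
Definition gen_mean kappa t : K :=
  if kappa is Some k then (\sum_(i < k.+1) i%:R * t ^+ i) / gen kappa t
  else t / (1 - t).

Lemma gen_fin_gt0 k t : 0 < t -> 0 < gen (Some k) t.
Proof.
move=> t0; rewrite /= big_ord_recl ltr_pwDl// sumr_ge0// => i _.
by rewrite exprn_ge0// ltW.
Qed.


Lemma gen_sum_le kappa t r : 0 < t -> (kappa = None -> t < 1) ->
  \sum_(j < r.+1 | leq_entry_bound j kappa) t ^+ j <= gen kappa t.
Proof.
case: kappa => [k|] t0 t1 /=.
  rewrite big_mkcond (big_ord_widen_cond (maxn r.+1 k.+1)
    (fun _ => true) (fun j => if (j <= k)%N then t ^+ j else 0)) ?leq_maxl//.
  rewrite (big_ord_widen_cond (maxn r.+1 k.+1) (fun _ => true)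
    (fun j => t ^+ j)) ?leq_maxr//.
  rewrite big_mkcond [leRHS]big_mkcond; apply: ler_sum => i _ /=.
  rewrite !ltnS; case: (i <= k)%N => //=; case: (i <= r)%N => //=.
  by rewrite exprn_ge0// ltW.
rewrite -[leRHS]mul1r ler_pdivlMr ?subr_gt0 ?t1// mulrC.
have := subrX1 t r.+1; have : 0 <= t ^+ r.+1 by rewrite exprn_ge0// ltW.
set S := \sum_(_ < _) _; set p := t ^+ _; nra.
Qed.

Lemma gen_gt0 kappa t : 0 < t -> (kappa = None -> t < 1) -> 0 < gen kappa t.
Proof.
case: kappa => [k|] t0 t1; first exact: gen_fin_gt0.
by rewrite /= invr_gt0 subr_gt0 t1.
Qed.

Lemma nomial_le_gen kappa n r t : 0 < t -> (kappa = None -> t < 1) ->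
  (nomial kappa n r)%:R * t ^+ r <= gen kappa t ^+ n.
Proof.
move=> t0 t1; elim: n r => [|n IH] r.
  by rewrite nomial0; case: r => [|r] /=; rewrite !expr0 ?mulr1 ?mul0r.
rewrite nomialS natr_sum mulr_suml exprS.
apply: (@le_trans _ _ (\sum_(j < r.+1 | leq_entry_bound j kappa)
    t ^+ j * gen kappa t ^+ n)).
  apply: ler_sum => j _; have -> : t ^+ r = t ^+ j * t ^+ (r - j).
    by rewrite -exprD subnKC// -ltnS.
  by rewrite mulrCA ler_wpM2l// exprn_ge0// ltW.
rewrite -mulr_suml ler_wpM2r ?gen_sum_le// exprn_ge0// ltW//.
exact: gen_gt0.
Qed.

Lemma sum_nomial k n t : 0 < t ->
  \sum_(r < (k * n).+1) (nomial (Some k) n r)%:R * t ^+ r = gen (Some k) t ^+ n.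
Proof.
move=> t0; pose P : {poly K} := \poly_(i < k.+1) 1.
have PE : P.[t] = gen (Some k) t.
  rewrite (horner_coef_wide _ (size_poly _ _)); apply: eq_bigr => i _.
  by rewrite coef_poly ltn_ord mul1r.
have coefP m r : (P ^+ m)`_r = (nomial (Some k) m r)%:R.
  elim: m r => [|m IH] r; first by rewrite nomial0 expr0 coef1; case: eqP.
  rewrite exprS coefM nomialS natr_sum [RHS]big_mkcond; apply: eq_bigr => j _.
  by rewrite coef_poly ltnS IH /=; case: ifP => _; rewrite ?mul1r ?mul0r.
rewrite -PE -horner_exp (@horner_coef_wide _ (k * n).+1).
  by apply: eq_bigr => i _; rewrite coefP.
apply: leq_trans (size_poly_exp_leq _ _) _; rewrite ltnS leq_mul2r.
by rewrite -subn1 leq_subLR add1n size_poly orbT.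
Qed.

(* [p_i (s^i) >= p_i s^y (1 + (i - y) ln s)] summed over the entries [i], where
   [y] is the mean. *)
Lemma gen_tilt k t s y : 0 < t -> 0 < s -> gen_mean (Some k) t = y ->
  gen (Some k) t * expR (y * ln s) <= gen (Some k) (t * s).
Proof.
move=> t0 s0 ty; have Z0 := gen_fin_gt0 k t0.
have yE : \sum_(i < k.+1) i%:R * t ^+ i = y * gen (Some k) t.
  by rewrite -ty /gen_mean divfK// gt_eqF.
apply: (@le_trans _ _ (\sum_(i < k.+1)
    t ^+ i * (expR (y * ln s) * (1 + (i%:R - y) * ln s)))).
  have -> : \sum_(i < k.+1) t ^+ i * (expR (y * ln s) * (1 + (i%:R - y) * ln s))
    = expR (y * ln s) * ((1 - y * ln s) * gen (Some k) t +
       ln s * \sum_(i < k.+1) i%:R * t ^+ i).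
    rewrite /gen !mulr_sumr -big_split mulr_sumr /=; apply: eq_bigr => i _.
    by ring.
  by rewrite yE; rewrite le_eqVlt; apply/predU1P; left; ring.
apply: ler_sum => i _; rewrite exprMn ler_wpM2l ?exprn_ge0 ?(ltW t0)//.
have -> : s ^+ i = expR (y * ln s) * expR ((i%:R - y) * ln s).
  by rewrite -expRD -mulrDl (addrC y) subrK expRM_natl lnK.
by rewrite ler_wpM2l ?expR_ge0// expR_ge1Dx.
Qed.

(* Log-concavity provides a tilt [s] for which [r] is the mode of the
   coefficients, so that the [r]-th term is at least the average one. *)
Lemma gen_le_nomial_fin k n r t : 0 < t -> (0 < k)%N -> (0 < n)%N ->
  gen_mean (Some k) t * n%:R = r%:R ->
  gen (Some k) t ^+ n <= (k * n).+1%:R * ((nomial (Some k) n r)%:R * t ^+ r).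
Proof.
move=> t0 k0 n0 mr; set Z := gen (Some k).
have Z0 s : 0 < s -> 0 < Z s by exact: gen_fin_gt0.
(* The entry 0 has positive weight, so the mean is strictly below [k]. Strictness makes [c r.+1]
   positive, as the tilt [s] requires. *)
have rkn : (r < k * n)%N.
  rewrite -(ltr_nat K) natrM -mr ltr_pM2r ?ltr0n// /gen_mean.
  rewrite ltr_pdivrMr ?Z0// /Z /gen mulr_sumr.
  rewrite ![\sum_(i < k.+1) _]big_ord_recl /= mul0r ltr_leD//.
    by rewrite mulr1 ltr0n.
  by apply: ler_sum => i _; rewrite ler_wpM2r ?ler_nat ?exprn_ge0 ?ltW//= lift0.
pose c j : K := (nomial (Some k) n j)%:R.
have c0 j : 0 <= c j by rewrite /c ler0n.
have cr0 : 0 < c r by rewrite ltr0n nomial_gt0// ltnW.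
have cr1 : 0 < c r.+1 by rewrite ltr0n nomial_gt0.
pose s := c r / c r.+1; have s0 : 0 < s by rewrite divr_gt0.
have up j : (j <= r)%N -> c j <= c j.+1 * s.
  move=> jr; rewrite mulrA ler_pdivlMr// -!natrM ler_nat.
  exact: log_concave_nomial.
have down j : (r <= j)%N -> c j.+1 * s <= c j.
  move=> jr; rewrite mulrA ler_pdivrMr// -!natrM ler_nat mulnC [leqRHS]mulnC.
  exact: log_concave_nomial.
have mode j : c j * s ^+ j <= c r * s ^+ r.
  case: (leqP j r) => jr.
    have H d : (j + d <= r)%N -> c j * s ^+ j <= c (j + d)%N * s ^+ (j + d).
      elim: d => [|d IH] dr; first by rewrite addn0.
      apply: le_trans (IH _) _; first by lia.
      rewrite addnS exprS mulrA ler_wpM2r ?exprn_ge0 ?(ltW s0)// up//; lia.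
    by have := H (r - j)%N; rewrite subnKC// leqnn; apply.
  rewrite -(subnKC (ltnW jr)); elim: (j - r)%N => [|d IH]; first by rewrite addn0.
  apply: le_trans IH; rewrite addnS exprS mulrA.
  by rewrite ler_wpM2r ?exprn_ge0 ?(ltW s0)// down// leq_addr.
have avg : Z s ^+ n <= (k * n).+1%:R * (c r * s ^+ r).
  rewrite -sum_nomial// [leRHS]mulr_natl.
  rewrite -[X in _ *+ X]card_ord -sumr_const; apply: ler_sum => j _.
  exact: mode.
(* The bound [avg] is at parameter [s]; [gen_tilt] carries it back to [t]. Its exponential factor to
   the power [n] is [(s / t) ^+ r], since [n] times the mean is [r]. *)
have st0 : 0 < s / t by rewrite divr_gt0.
have := @gen_tilt k t (s / t) _ t0 st0 erefl.
rewrite (mulrC t (s / t)) divfK ?gt_eqF// -/(Z t) -/(Z s) => tilt.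
have : Z t ^+ n * (s / t) ^+ r <= Z s ^+ n.
  have -> : (s / t) ^+ r = expR (gen_mean (Some k) t * ln (s / t)) ^+ n.
    by rewrite -expRM_natr [_ * ln _ * _]mulrAC mr expRM_natl lnK.
  by rewrite -exprMn lerXn2r ?nnegrE// ?mulr_ge0 ?expR_ge0 ?ltW ?Z0// mulrC.
rewrite expr_div_n [X in X <= _ -> _]mulrA ler_pdivrMr ?exprn_gt0// => /le_trans H0.
have {H0} H := H0 _ (ler_wpM2r (exprn_ge0 r (ltW t0)) avg).
rewrite -(@ler_pM2r _ (s ^+ r)) ?exprn_gt0//; apply: le_trans H _.
by rewrite le_eqVlt; apply/predU1P; left; rewrite /c; ring.
Qed.

(* With [u = t / (1 - t)], [nomial None n r] is essentially the binomial
   coefficient ['C(n + r, r)], to which the bound for entries in {0, 1} applies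
   at [u]. *)
Lemma gen_le_nomial_oo n r t : 0 < t -> t < 1 -> (0 < n)%N ->
  gen_mean None t * n%:R = r%:R ->
  gen None t ^+ n <= (r.+1 * (n + r).+1)%:R * ((nomial None n r)%:R * t ^+ r).
Proof.
case: n => // n t0 t1 _ mr; set N := (n.+1 + r)%N.
have t1' : 1 - t != 0 by rewrite subr_eq0 gt_eqF.
have rE : r%:R = t / (1 - t) * n.+1%:R by rewrite -mr.
pose u := t / (1 - t); have u0 : 0 < u by rewrite divr_gt0// subr_gt0.
have N0 : N%:R != 0 :> K by rewrite pnatr_eq0.
have gu : gen (Some 1%N) u = (1 - t)^-1.
  by rewrite /= !big_ord_recl big_ord0 /= expr0 expr1 /u; field.
have mu : gen_mean (Some 1%N) u * N%:R = r%:R.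
  rewrite /gen_mean gu !big_ord_recl big_ord0 /= mul0r expr1 mul1r add0r addr0.
  by rewrite /u /N natrD rE; field.
have := @gen_le_nomial_fin 1 N r u u0 isT isT mu.
rewrite gu mul1n nomial1_bin => H.
have q0 : 0 < (1 - t) ^+ r by rewrite exprn_gt0// subr_gt0.
have {H} : (1 - t)^-1 ^+ n.+1 <= N.+1%:R * ('C(N, r)%:R * t ^+ r).
  rewrite -(@ler_pM2r _ ((1 - t)^-1 ^+ r)) ?exprn_gt0 ?invr_gt0 ?subr_gt0//.
  by rewrite -exprD; apply: le_trans H _; rewrite /u expr_div_n exprVn !mulrA.
move=> /le_trans; apply; rewrite mulrA [leRHS]mulrA ler_wpM2r//.
  by rewrite exprn_ge0// ltW.
rewrite -!natrM ler_nat nomialoo_bin -(@leq_pmul2r n.+1)//.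
have := mul_bin_down N r; rewrite /N addnK addSn /= => E.
rewrite -mulnA [('C(_, _) * n.+1)%N]mulnC -E.
have := leq0n ('C(n + r, r)); set C := 'C(n + r, r); nia.
Qed.

(** One polynomial factor that dominates both [(k * n).+1] and [r.+1 * (n + r).+1], so that the two
    kinds of bounds can be treated together. *)
Definition prefactor kappa n r : nat := ((odflt 1 kappa * n + r).+1 ^ 2)%N.

Lemma gen_le_nomial kappa n r t : leq_entry_bound 1%N kappa ->
  0 < t -> (kappa = None -> t < 1) -> (0 < n)%N ->
  gen_mean kappa t * n%:R = r%:R ->
  gen kappa t ^+ n <= (prefactor kappa n r)%:R * ((nomial kappa n r)%:R * t ^+ r).
Proof.
case: kappa => [k|] k1 t0 t1 n0 mr.
  apply: le_trans (gen_le_nomial_fin t0 k1 n0 mr) _; rewrite ler_wpM2r//.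
    by rewrite mulr_ge0// exprn_ge0// ltW.
  by rewrite ler_nat /prefactor /=; nia.
apply: le_trans (gen_le_nomial_oo t0 (t1 erefl) n0 mr) _; rewrite ler_wpM2r//.
  by rewrite mulr_ge0// exprn_ge0// ltW.
by rewrite ler_nat /prefactor /= mul1n; nia.
Qed.

End GeneratingFunction.

End NomialBounds.

(** * Counting matrices with given margins *)

Lemma leq_card_inj (T T' : finType) (f : T -> T') (A : {set T}) (B : {set T'}) :
  {in A, forall x, f x \in B} -> {in A &, injective f} -> #|A| <= #|B|.
Proof.
move=> fAB fI; rewrite -(card_in_imset fI); apply: subset_leq_card.
by apply/fintype.subsetP => _ /imsetP[x xA ->]; exact: fAB.
Qed.

Lemma sum_pair (Q J : finType) (f : Q * J -> nat) :
  (\sum_x f x = \sum_q \sum_j f (q, j))%N.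
Proof. by rewrite pair_bigA; apply: eq_bigr => -[]. Qed.

Section Margins.
Variables (kappa : entry_bound) (B : nat).
Implicit Types (I J P Q : finType).

(* Matrices are functions on [I * J]; arbitrary index types make block
   decompositions and clones painless. [B] only makes the entry type finite. *)
Definition margins I J (r : I -> nat) (c : J -> nat) :
    {set {ffun I * J -> 'I_B.+1}} :=
  [set W : {ffun I * J -> 'I_B.+1} |
    [&& [forall x, leq_entry_bound (W x) kappa],
        [forall i, (\sum_j W (i, j))%N == r i] &
        [forall j, (\sum_i W (i, j))%N == c j]]].

Lemma marginsP I J (r : I -> nat) (c : J -> nat) (W : {ffun I * J -> 'I_B.+1}) :
  reflect [/\ forall i j, leq_entry_bound (W (i, j)) kappa,
              forall i, (\sum_j W (i, j))%N = r i &
              forall j, (\sum_i W (i, j))%N = c j] (W \in margins r c).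
Proof.
rewrite inE; apply: (iffP and3P) => [[/forallP Wk /forallP Wr /forallP Wc]|].
  by split=> [i j|i|j]; [exact: Wk|exact/eqP|exact/eqP].
move=> [Wk Wr Wc]; split; apply/forallP; first by case.
  by move=> i; apply/eqP.
by move=> j; apply/eqP.
Qed.

Lemma leq_card_margins_reindex I J I' J' (f : I' -> I) (h : J' -> J)
    (r : I -> nat) (c : J -> nat) : bijective f -> bijective h ->
  #|margins r c| <= #|margins (r \o f) (c \o h)|.
Proof.
move=> fB hB; have [f' _ fK] := fB; have [h' _ hK] := hB.
pose F (W : {ffun I * J -> 'I_B.+1}) : {ffun I' * J' -> 'I_B.+1} :=
  [ffun x => W (f x.1, h x.2)].
apply: (@leq_card_inj _ _ F) => [W /marginsP[Wk Wr Wc]|W W' _ _ E].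
  apply/marginsP; split=> [i j|i|j]; first by rewrite ffunE; exact: Wk.
    rewrite /= -Wr (reindex h) /=; last exact: onW_bij.
    by apply: eq_bigr => j _; rewrite ffunE.
  rewrite /= -Wc (reindex f) /=; last exact: onW_bij.
  by apply: eq_bigr => i _; rewrite ffunE.
apply/ffunP => -[i j]; move/ffunP/(_ (f' i, h' j)) : E.
by rewrite !ffunE /= fK hK.
Qed.

(* [r' p q] and [c' p q] are the margins of the block [(p, q)]. *)
Lemma prod_card_margins P Q I J (r' : P -> Q -> I -> nat) (c' : P -> Q -> J -> nat)
    (r : P * I -> nat) (c : Q * J -> nat) :
  (forall x, (\sum_q r' x.1 q x.2)%N = r x) ->
  (forall y, (\sum_p c' p y.1 y.2)%N = c y) ->
  (\prod_p \prod_q #|margins (r' p q) (c' p q)| <= #|margins r c|)%N.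
Proof.
move=> rE cE; rewrite pair_bigA /=.
pose Fam (x : P * Q) := [in margins (r' x.1 x.2) (c' x.1 x.2)].
have -> : (\prod_(x : P * Q) #|margins (r' x.1 x.2) (c' x.1 x.2)| =
    #|[set D : {ffun P * Q -> {ffun I * J -> 'I_B.+1}} in family Fam]|)%N.
  rewrite cardsE card_family foldrE big_map -big_enum.
  by apply: eq_bigr => x _; apply: eq_card => y.
pose F (D : {ffun P * Q -> {ffun I * J -> 'I_B.+1}}) :
    {ffun (P * I) * (Q * J) -> 'I_B.+1} :=
  [ffun x => D (x.1.1, x.2.1) (x.1.2, x.2.2)].
apply: (@leq_card_inj _ _ F) => [D|D D' _ _ E].
  rewrite inE => /familyP DF.
  have DP p q := marginsP _ _ _ (DF (p, q)).
  apply/marginsP; split=> [[p i] [q j]|[p i]|[q j]].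
  - by rewrite ffunE; case: (DP p q).
  - rewrite -rE /= sum_pair /=.
    apply: eq_bigr => q _; have [_ <- _] := DP p q.
    by apply: eq_bigr => j _; rewrite ffunE.
  - rewrite -cE /= sum_pair /=.
    apply: eq_bigr => p _; have [_ _ <-] := DP p q.
    by apply: eq_bigr => i _; rewrite ffunE.
apply/ffunP => -[p q]; apply/ffunP => -[i j].
by move/ffunP/(_ ((p, i), (q, j))) : E; rewrite !ffunE.
Qed.

(* Borders a matrix with copies of [V]. *)
Lemma leq_card_margins_border P I J (r : I -> nat) (c : J -> nat)
    (rP : P * I -> nat) (cP : P * J -> nat)
    (r' : (P * I) + I -> nat) (c' : (P * J) + J -> nat) :
  (0 < #|margins r c|)%N ->
  (forall x, r' (inl x) = rP x + r x.2)%N -> (forall i, r' (inr i) = #|P|.+1 * r i)%N ->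
  (forall y, c' (inl y) = cP y + c y.2)%N -> (forall j, c' (inr j) = #|P|.+1 * c j)%N ->
  (#|margins rP cP| <= #|margins r' c'|)%N.
Proof.
move=> /card_gt0P[V /marginsP[Vk Vr Vc]] rl rr cl cr.
pose F (W : {ffun (P * I) * (P * J) -> 'I_B.+1}) :
    {ffun ((P * I) + I) * ((P * J) + J) -> 'I_B.+1} :=
  [ffun z => match z.1, z.2 with
     | inl x, inl y => W (x, y)
     | inl x, inr j => V (x.2, j)
     | inr i, inl y => V (i, y.2)
     | inr i, inr j => V (i, j) end].
apply: (@leq_card_inj _ _ F) => [W /marginsP[Wk Wr Wc]|W W' _ _ E].
  apply/marginsP; split=> [[x|i] [y|j]|[x|i]|[y|j]]; rewrite ?ffunE //=.
  - rewrite big_sumType /= rl -Wr -Vr; congr (_ + _)%N;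
      by apply: eq_bigr => j _; rewrite ffunE.
  - rewrite big_sumType /= rr mulSnr -Vr; congr (_ + _)%N; last first.
      by apply: eq_bigr => j _; rewrite ffunE.
    rewrite sum_pair /=.
    rewrite -sum_nat_const; apply: eq_bigr => p _; apply: eq_bigr => j _.
    by rewrite ffunE.
  - rewrite big_sumType /= cl -Wc -Vc; congr (_ + _)%N;
      by apply: eq_bigr => j _; rewrite ffunE.
  - rewrite big_sumType /= cr mulSnr -Vc; congr (_ + _)%N; last first.
      by apply: eq_bigr => i _; rewrite ffunE.
    rewrite sum_pair /=.
    rewrite -sum_nat_const; apply: eq_bigr => p _; apply: eq_bigr => i _.
    by rewrite ffunE.
apply/ffunP => -[x y]; move/ffunP/(_ (inl x, inl y)) : E.
by rewrite !ffunE.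
Qed.

(** Each cell contributes the polynomial [G] of its allowed values up to [B]. The cut at [B] does
    not affect coefficients of degree at most [A], so unbounded entries are also handled by
    polynomials. *)
Lemma card_nomial (T : finType) A : (A <= B)%N ->
  #|[set W : {ffun T -> 'I_B.+1} | [forall x, leq_entry_bound (W x) kappa] &&
      ((\sum_x W x)%N == A)]| = nomial kappa #|T| A.
Proof.
move=> AB; pose G : {poly nat} := (\sum_(j < B.+1 | leq_entry_bound j kappa) 'X^j)%R.
have GE j : (j <= B)%N -> (G`_j)%R = leq_entry_bound j kappa :> nat.
  move=> jB; rewrite coef_sum; have jB' : (j < B.+1)%N by [].
  rewrite big_mkcond (bigD1 (Ordinal jB')) //= coefXn eqxx.
  rewrite big1 ?addr0; first by case: leq_entry_bound.
  move=> i /eqP/val_eqP /= ij; rewrite coefXn eq_sym (negbTE ij).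
  by case: leq_entry_bound.
have nE n D : (D <= B)%N -> nomial kappa n D = ((G ^+ n)`_D)%R.
  elim: n D => [|n IH] D DB; first by rewrite nomial0 expr0 coef1; case: eqP.
  rewrite exprS coefM nomialS big_mkcond; apply: eq_bigr => -[j jD] _ /=.
  rewrite GE; last by lia.
  by rewrite IH ?(leq_trans (leq_subr _ _))//; case: ifP => _; rewrite ?mul1r ?mul0r.
rewrite nE// -[in RHS]prodr_const.
rewrite (eq_bigl xpredT)// /G.
rewrite (bigA_distr_big [pred j : 'I_B.+1 | leq_entry_bound j kappa]) coef_sum.
rewrite -sum1_card big_mkcond [RHS]big_mkcond; apply: eq_bigr => W _ /=.
rewrite inE prodrXr coefXn.
have -> : (W \in ffun_on [pred j : 'I_B.+1 | leq_entry_bound j kappa]) =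
    [forall x, leq_entry_bound (W x) kappa].
  by apply/ffun_onP/forallP.
by rewrite eq_sym; case: ifP; case: [forall x, _]; case: (A == _)%N.
Qed.

Lemma sum_row_margins I J (r : I -> nat) (c : J -> nat) (W : {ffun I * J -> 'I_B.+1}) :
  W \in margins r c -> (\sum_x W x = \sum_i r i)%N.
Proof.
by move=> /marginsP[_ Wr _]; rewrite sum_pair; apply: eq_bigr => i _.
Qed.

Lemma card_margins_le_nomial I J (r : I -> nat) (c : J -> nat) :
  (\sum_i r i <= B)%N ->
  (#|margins r c| <= nomial kappa (#|I| * #|J|) (\sum_i r i))%N.
Proof.
move=> rB; rewrite -card_prod -card_nomial//; apply: subset_leq_card.
apply/fintype.subsetP => W WM; rewrite inE (sum_row_margins WM) eqxx andbT.
by move: WM; rewrite inE => /and3P[].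
Qed.

(* There are at most [A.+1 ^ (#|I| + #|J|)] possible margins. *)
Lemma pigeonhole_margins I J A : (A <= B)%N ->
  (0 < nomial kappa (#|I| * #|J|) A)%N ->
  exists (r : I -> nat) (c : J -> nat),
    [/\ (\sum_i r i = A)%N, (\sum_j c j = A)%N &
        (nomial kappa (#|I| * #|J|) A <=
         #|margins r c| * A.+1 ^ (#|I| + #|J|))%N].
Proof.
move=> AB; rewrite -card_prod -card_nomial//; set S := [set W | _] => S0.
pose row (W : {ffun I * J -> 'I_B.+1}) i := (\sum_j W (i, j))%N.
pose col (W : {ffun I * J -> 'I_B.+1}) j := (\sum_i W (i, j))%N.
have totr W : W \in S -> (\sum_i row W i = A)%N.
  by rewrite inE => /andP[_ /eqP <-]; rewrite sum_pair.
have totc W : W \in S -> (\sum_j col W j = A)%N.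
  by rewrite inE => /andP[_ /eqP <-]; rewrite sum_pair exchange_big.
pose Y := ({ffun I -> 'I_A.+1} * {ffun J -> 'I_A.+1})%type.
pose phi W : Y := ([ffun i => inord (row W i)], [ffun j => inord (col W j)]).
have cardY : #|{: Y}| = (A.+1 ^ (#|I| + #|J|))%N.
  by rewrite card_prod !card_ffun !card_ord expnD.
have [y yS] : exists y : Y, (#|S| <= #|[set W in S | phi W == y]| * #|{: Y}|)%N.
  apply/existsP; apply: contraLR S0 => /existsPn H.
  have : (#|S| * #|{: Y}| <= \sum_(y : Y) #|[set W in S | phi W == y]| * #|{: Y}|)%N.
    rewrite -big_distrl leq_mul2r; apply/orP; right.
    rewrite -sum1_card (partition_big phi xpredT)//=; apply: leq_sum => y _.
    by rewrite -sum1_card; apply: eq_leq; apply: eq_bigl => W; rewrite !inE.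
  rewrite -leqNgt leqn0 => le; apply/eqP.
  (* If every fibre were too small, each term could be raised by one unit, and the sum would exceed
     the total by [#|{: Y}|]. *)
  have : (\sum_(y : Y) (#|[set W in S | phi W == y]| * #|{: Y}|).+1 <= #|S| * #|{: Y}|)%N.
    rewrite mulnC -sum_nat_const; apply: leq_sum => y _.
    by rewrite ltnNge H.
  rewrite (eq_bigr (fun y => (#|[set W in S | phi W == y]| * #|{: Y}|) + 1)%N); last first.
    by move=> y _; rewrite addn1.
  rewrite big_split /= sum_nat_const muln1.
  have : (0 < #|{: Y}|)%N by rewrite cardY expn_gt0.
  move=> Y0 /leq_trans/(_ le); rewrite -[leqRHS]addn0 leq_add2l leqNgt.
  by move=> /negP[]; exact: Y0.
have /card_gt0P[W] : (0 < #|[set W in S | phi W == y]|)%N.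
  by case: posnP yS => // ->; rewrite mul0n leqNgt S0.
rewrite inE => /andP[WS /eqP phiW]; exists (row W), (col W).
split; [exact: totr|exact: totc|]; apply: leq_trans yS _; rewrite cardY.
rewrite leq_mul2r; apply/orP; right; apply: subset_leq_card.
apply/fintype.subsetP => V; rewrite inE => /andP[VS /eqP phiV].
have rowA U i : U \in S -> (row U i < A.+1)%N.
  by move=> /totr <-; rewrite ltnS (bigD1 i)//= leq_addr.
have colA U j : U \in S -> (col U j < A.+1)%N.
  by move=> /totc <-; rewrite ltnS (bigD1 j)//= leq_addr.
move: phiV; rewrite -phiW => -[/ffunP Er /ffunP Ec].
apply/marginsP; split=> [i j|i|j].
- by move: VS; rewrite inE => /andP[/forallP + _]; exact.
- by have /(congr1 val) := Er i; rewrite !ffunE /= !inordK ?rowA.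
- by have /(congr1 val) := Ec j; rewrite !ffunE /= !inordK ?colA.
Qed.

(* Arranging the [s.+1 ^ 2] simultaneous cyclic shifts of the margins as
   blocks makes all line sums equal to the total [A]. *)
Lemma symmetrize_margins s A (r c : 'I_s.+1 -> nat) :
  (\sum_i r i = A)%N -> (\sum_j c j = A)%N ->
  (#|margins r c| ^ (s.+1 * s.+1) <=
   #|margins (fun _ : 'I_s.+1 * 'I_s.+1 => A) (fun _ : 'I_s.+1 * 'I_s.+1 => A)|)%N.
Proof.
move=> rA cA.
have shiftB (q : 'I_s.+1) : bijective (fun i : 'I_s.+1 => (i + q)%R).
  by exists (fun i => (i - q)%R) => i; rewrite ?addrK ?subrK.
have shiftB' (q : 'I_s.+1) : bijective (fun i : 'I_s.+1 => (q + i)%R).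
  exists (fun i => (i - q)%R) => i; first by rewrite addrC addKr.
  by rewrite addrC subrK.
(* Block [(p, q)] has [r] shifted by [q] and [c] shifted by [p]: along a row of blocks [q] takes
   every value, so each row meets every value of [r] once, and likewise for columns. *)
apply: leq_trans (prod_card_margins (r' := fun _ q i => r (i + q)%R)
  (c' := fun p _ j => c (j + p)%R) _ _); last 2 first.
- move=> [p i] /=; rewrite -[RHS]rA [RHS](reindex (fun q => (i + q)%R))//.
  exact: onW_bij.
- move=> [q j] /=; rewrite -[RHS]cA [RHS](reindex (fun p => (j + p)%R))//.
  exact: onW_bij.
have -> x : (x ^ (s.+1 * s.+1) = \prod_(p < s.+1) \prod_(q < s.+1) x)%N.
  by rewrite !prod_nat_const !card_ord -expnM.
apply: leq_prod => p _; apply: leq_prod => q _.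
by apply: (leq_card_margins_reindex (f := fun i => (i + q)%R) (h := fun j => (j + p)%R)).
Qed.

End Margins.

(* [r] lists the sequence [R] in some order, repetitions included. *)
Definition indexes (I : finType) (r : I -> nat) (R : seq nat) :=
  forall F : nat -> nat, (\sum_i F (r i) = \sum_(x <- R) F x)%N.

(** Taking indicator functions for [F] shows that all multiplicities agree, so the values of [r] are
    a permutation of [R]. *)
Lemma indexes_bij (I : finType) (r : I -> nat) (R : seq nat) : indexes r R ->
  exists2 f : I -> 'I_(size R), bijective f & forall i, r i = nth 0%N R (f i).
Proof.
move=> rR; have /(perm_iotaP 0%N)[Is IsP rE] : perm_eq (codom r) R.
  apply/permP => a; have := rR (fun x => a x : nat).
  move=> E; rewrite -!sum1_count big_map big_mkcond [RHS]big_mkcond /= big_enum.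
  exact: E.
have szI : size Is = #|I| by rewrite -(size_map (nth 0%N R)) -rE size_codom.
have uIs : uniq Is by rewrite (perm_uniq IsP) iota_uniq.
have fP (i : I) : (nth 0 Is (enum_rank i) < size R)%N.
  have : nth 0%N Is (enum_rank i) \in Is by rewrite mem_nth// szI.
  by rewrite (perm_mem IsP) mem_iota.
pose f i := Ordinal (fP i); have fI : injective f.
  move=> i j /(congr1 val) /= /eqP; rewrite nth_uniq ?szI// => /eqP.
  by move=> /val_inj /enum_rank_inj.
exists f; last first.
  move=> i; have <- : nth 0%N (codom r) (enum_rank i) = r i.
    by rewrite nth_codom enum_rankK.
  by rewrite rE (nth_map 0%N) ?szI.
apply: inj_card_bij => //.
by rewrite card_ord -szI (perm_size IsP) size_iota.
Qed.

Lemma num_transport_nth kappa B (R C : seq nat) :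
  (forall i, nth 0%N R i <= B)%N ->
  num_transport kappa R C =
  #|margins kappa B (fun i : 'I_(size R) => nth 0%N R i)
      (fun j : 'I_(size C) => nth 0%N C j)|.
Proof.
move=> RB; set S := margins _ _ _ _.
pose mx (W : {ffun 'I_(size R) * 'I_(size C) -> 'I_B.+1}) :
    'M[nat]_(size R, size C) := (\matrix_(i, j) (W (i, j) : nat))%R.
have mxI : injective mx.
  move=> W W' /matrixP E; apply/ffunP => -[i j]; apply: val_inj.
  by have := E i j; rewrite !mxE.
have -> : num_transport kappa R C = #|` [fset mx W | W in S]%fset|.
  congr #|` _|%fset; apply/fsetP => V; rewrite in_fset_set; last first.
    exact: finite_transport_matrices.
  apply/idP/imfsetP => [|[W /= WS ->]]; rewrite inE.
    move=> [Vk Vr Vc]; exists [ffun x => inord (V x.1 x.2)] => /=; last first.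
      apply/matrixP => i j; rewrite !mxE ffunE inordK// ltnS.
      by apply: leq_trans (RB i); rewrite -Vr (bigD1 j)//= leq_addr.
    have VB i j : (V i j < B.+1)%N.
      by rewrite ltnS; apply: leq_trans (RB i); rewrite -Vr (bigD1 j)//= leq_addr.
    apply/marginsP; split=> [i j|i|j].
    - by rewrite ffunE /= inordK.
    - by rewrite -Vr; apply: eq_bigr => j _; rewrite ffunE /= inordK.
    - by rewrite -Vc; apply: eq_bigr => i _; rewrite ffunE /= inordK.
  move/marginsP: WS => [Wk Wr Wc]; split=> [i j|i|j]; first by rewrite mxE.
    by rewrite -Wr; apply: eq_bigr => j _; rewrite mxE.
  by rewrite -Wc; apply: eq_bigr => i _; rewrite mxE.
rewrite card_imfset// cardE; apply: perm_size.
apply: uniq_perm; [exact: enum_finmem_uniq|exact: enum_uniq|].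
by move=> W; rewrite enum_finmemE.
Qed.

(** Allows clones to be counted over product and sum index types. Reindexing is injective in both
    directions, which gives the two inequalities. *)
Lemma num_transportE kappa B (I J : finType) (r : I -> nat) (c : J -> nat) R C :
  indexes r R -> indexes c C -> (forall i, r i <= B)%N ->
  num_transport kappa R C = #|margins kappa B r c|.
Proof.
move=> rR cC rB; have [f fB rE] := indexes_bij rR; have [h hB cE] := indexes_bij cC.
have [f' fK f'K] := fB; have [h' hK h'K] := hB.
rewrite (@num_transport_nth kappa B).
  pose r0 (i : 'I_(size R)) := nth 0%N R i; pose c0 (j : 'I_(size C)) := nth 0%N C j.
  have -> : r = r0 \o f by apply/funext.
  have -> : c = c0 \o h by apply/funext.
  apply/eqP; rewrite eqn_leq leq_card_margins_reindex//=.
  have E1 : r0 = (r0 \o f) \o f' by apply/funext => i /=; rewrite f'K.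
  have E2 : c0 = (c0 \o h) \o h' by apply/funext => i /=; rewrite h'K.
  rewrite -/r0 -/c0 [in leqRHS]E1 [in leqRHS]E2.
  by apply: leq_card_margins_reindex; [exists f|exists h].
move=> i; case: (ltnP i (size R)) => [iR|Ri]; last by rewrite nth_default.
by have := rB (f' (Ordinal iR)); rewrite rE f'K.
Qed.

Lemma indexes_clone (I P : finType) (r : I -> nat) R s :
  indexes r R -> #|P| = s -> indexes (fun x : P * I => s * r x.2)%N (clone s R).
Proof.
move=> rR Ps F; rewrite sum_pair /=.
have -> : (\sum_(q : P) \sum_j F (s * r j) = #|P| * \sum_j F (s * r j))%N.
  by rewrite sum_nat_const.
rewrite (rR (fun x => F (s * x)%N)) Ps /clone.
have -> : (\sum_(x <- R) F (s * x) = \sum_(y <- [seq (s * x)%N | x <- R]) F y)%N.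
  by rewrite big_map.
elim: {Ps}s [seq _ | x <- R] => [|n IH] l; first by rewrite big_nil.
by rewrite mulSn IH /= big_cat.
Qed.

Lemma indexes_tuple m (R : m.-tuple nat) : indexes (tnth R) R.
Proof. by move=> F; rewrite big_tuple. Qed.

Lemma sum_clone (R : seq nat) s : sumn (clone s R) = (s * s * sumn R)%N.
Proof.
rewrite /clone sumn_flatten map_nseq sumn_nseq -mulnA mulnC; congr (_ * _)%N.
by elim: R => [|x R IH] /=; rewrite ?muln0// IH mulnDr.
Qed.

Lemma indexes_reindex (I I' : finType) (f : I' -> I) (r : I -> nat) R :
  bijective f -> indexes r R -> indexes (r \o f) R.
Proof.
move=> fB rR F; rewrite -(rR F) [RHS](reindex f) //; exact: onW_bij.
Qed.

Lemma tnth_le_sumn m (R : m.-tuple nat) i : (tnth R i <= sumn R)%N.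
Proof. by rewrite sumnE big_tuple (bigD1 i)//= leq_addr. Qed.

(** * Growth of the counts under cloning *)

Section Transport.
Variables (kappa : entry_bound) (m n : nat) (R : m.-tuple nat) (C : n.-tuple nat).

Lemma num_transport_le_nomial (R' C' : seq nat) :
  (num_transport kappa R' C' <= nomial kappa (size R' * size C') (sumn R'))%N.
Proof.
have sE : (\sum_(i < size R') nth 0%N R' i = sumn R')%N.
  by rewrite sumnE (big_nth 0%N) big_mkord.
rewrite (@num_transport_nth kappa (sumn R')); last first.
  move=> i; case: (ltnP i (size R')) => [iR|Ri]; last by rewrite nth_default.
  by rewrite -sE (bigD1 (Ordinal iR))//= leq_addr.
by rewrite -sE; apply: leq_trans (card_margins_le_nomial _ _ _) _ => //;
  rewrite !card_ord.
Qed.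

Let T s := num_transport kappa (clone s R) (clone s C).

Lemma num_transport_clone (P I J : finType) (r : I -> nat) (c : J -> nat) B s :
  indexes r R -> indexes c C -> #|P| = s -> (forall i, s * r i <= B)%N ->
  T s = #|margins kappa B (fun x : P * I => s * r x.2)%N
    (fun y : P * J => s * c y.2)%N|.
Proof.
move=> rR cC Ps rB; apply: num_transportE => //; exact: indexes_clone.
Qed.

(** A [k] by [k] array of independently chosen matrices for the clone of order [s] has the margins
    of the clone of order [k * s]. This is the supermultiplicativity behind the limit. *)
Lemma num_transport_clone_mul k s : (T s ^ (k * k) <= T (k * s))%N.
Proof.
(* The second summand keeps [B] large enough for [T s] when [k = 0]. *)
set B := (k * s * sumn R + s * sumn R)%N.
have RB l i : (l <= k * s + s)%N -> (l * tnth R i <= B)%N.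
  by move=> lk; rewrite /B -mulnDl leq_mul// tnth_le_sumn.
rewrite (@num_transport_clone 'I_s _ _ _ _ B s (@indexes_tuple _ R)
  (@indexes_tuple _ C)) ?card_ord//; last by move=> i; rewrite RB// leq_addl.
pose f d (x : 'I_k * ('I_s * 'I_d)) := ((x.1, x.2.1), x.2.2).
have fB d : bijective (@f d).
  by exists (fun y => (y.1.1, (y.1.2, y.2))) => [[? [? ?]]|[[? ?] ?]].
have card_ks : #|{: 'I_k * 'I_s}| = (k * s)%N by rewrite card_prod !card_ord.
have rI := indexes_reindex (fB m) (indexes_clone (@indexes_tuple _ R) card_ks).
have cI := indexes_reindex (fB n) (indexes_clone (@indexes_tuple _ C) card_ks).
rewrite /T (num_transportE kappa (B := B) rI cI); last first.
  by move=> x /=; rewrite RB// leq_addr.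
have -> x : (x ^ (k * k) = \prod_(p < k) \prod_(q < k) x)%N.
  by rewrite !prod_nat_const !card_ord -expnM.
by apply: prod_card_margins => x; rewrite sum_nat_const card_ord mulnA.
Qed.

(** Borders with one fixed matrix of margins [R] and [C]. Monotonicity is what extends the limit
    from multiples of a given order to all orders. *)
Lemma num_transport_clone_le s : (0 < num_transport kappa R C)%N -> (T s <= T s.+1)%N.
Proof.
move=> T1; set B := (s.+1 * sumn R)%N.
have RB l i : (l <= s.+1)%N -> (l * tnth R i <= B)%N.
  by move=> ls; rewrite /B leq_mul// tnth_le_sumn.
rewrite (@num_transport_clone 'I_s _ _ _ _ B s (@indexes_tuple _ R)
  (@indexes_tuple _ C)) ?card_ord//; last by move=> i; rewrite RB.
pose f d (x : ('I_s * 'I_d) + 'I_d) : option 'I_s * 'I_d :=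
  match x with inl y => (Some y.1, y.2) | inr i => (None, i) end.
have fB d : bijective (@f d).
  exists (fun y => if y.1 is Some p then inl (p, y.2) else inr y.2).
    by move=> [[? ?]|?].
  by move=> [[?|] ?].
have card_s : #|{: option 'I_s}| = s.+1 by rewrite card_option card_ord.
have rI := indexes_reindex (fB m) (indexes_clone (@indexes_tuple _ R) card_s).
have cI := indexes_reindex (fB n) (indexes_clone (@indexes_tuple _ C) card_s).
rewrite /T (num_transportE kappa (B := B) rI cI); last first.
  by move=> x /=; rewrite RB.
apply: (leq_card_margins_border (r := tnth R) (c := tnth C)).
- rewrite -(num_transportE kappa (B := B) (@indexes_tuple _ R) (@indexes_tuple _ C))//.
  by move=> i; rewrite -[tnth R i]mul1n RB.
- by move=> [p i] /=; rewrite mulSnr.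
- by move=> i /=; rewrite card_ord.
- by move=> [p j] /=; rewrite mulSnr.
- by move=> j /=; rewrite card_ord.
Qed.

(** In the clone of order [s.+1 ^ 2], block [(i, j)] gets constant line sums [A i j]. It is itself
    cut into [s.+1 ^ 2] squares of side [s.+1], whose margins come from the pigeonhole. The factor
    lost has logarithm of order [s^3 ln s], negligible against [s^4]. *)
Lemma num_transport_clone_ge s (A : 'I_m -> 'I_n -> nat) :
  (forall i, \sum_j A i j = s.+1 * s.+1 * tnth R i)%N ->
  (forall j, \sum_i A i j = s.+1 * s.+1 * tnth C j)%N ->
  (forall i j, 0 < nomial kappa (s.+1 * s.+1) (A i j))%N ->
  (\prod_i \prod_j nomial kappa (s.+1 * s.+1) (A i j) ^ (s.+1 * s.+1) <=
   T (s.+1 * s.+1) *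
     \prod_i \prod_j ((A i j).+1 ^ (s.+1 + s.+1)) ^ (s.+1 * s.+1))%N.
Proof.
move=> rA cA nom0; set S := (s.+1 * s.+1)%N; set B := (S * sumn R)%N.
have RB i : (S * tnth R i <= B)%N by rewrite leq_mul// tnth_le_sumn.
have AB i j : (A i j <= B)%N.
  by apply: leq_trans (RB i); rewrite -rA (bigD1 j)//= leq_addr.
pose P := ('I_s.+1 * 'I_s.+1)%type.
have cardP : #|{: P}| = S by rewrite card_prod !card_ord.
pose f d (x : 'I_d * P) : P * 'I_d := (x.2, x.1).
have fB d : bijective (@f d) by exists (fun y => (y.2, y.1)) => -[].
have rI := indexes_reindex (fB m) (indexes_clone (@indexes_tuple _ R) cardP).
have cI := indexes_reindex (fB n) (indexes_clone (@indexes_tuple _ C) cardP).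
rewrite /T (num_transportE kappa (B := B) rI cI); last by move=> x /=.
have := @prod_card_margins kappa B 'I_m 'I_n P P (fun i j _ => A i j)
  (fun i j _ => A i j) _ _ (fun x => rA x.1) (fun y => cA y.1).
move=> H; apply: leq_trans (leq_mul H (leqnn _)).
rewrite -big_split; apply: leq_prod => i _; rewrite -big_split; apply: leq_prod => j _ /=.
have n0 := nom0 i j.
have := @pigeonhole_margins kappa B 'I_s.+1 'I_s.+1 (A i j) (AB i j).
rewrite !card_ord => /(_ n0)[r [c [rE cE le]]].
apply: leq_trans (leq_mul (symmetrize_margins _ _ rE cE) (leqnn _)).
by rewrite -expnMn leq_exp2r.
Qed.

End Transport.

Local Open Scope classical_set_scope.
Local Open Scope ring_scope.

(** * Jensen's inequality in two variables *)

Lemma mean_value (K : realType) (f df : K -> K) (a b : K) : a < b ->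
  (forall x, a < x < b -> is_derive x 1 f (df x)) ->
  (forall x, a <= x <= b -> {for x, continuous f}) ->
  exists2 c, a < c < b & f b - f a = df c * (b - a).
Proof.
move=> ab dfE cf.
have dfE' x : x \in `]a, b[ -> is_derive x 1 f (df x) by rewrite in_itv; exact: dfE.
have cf' : {within `[a, b], continuous f}.
  by apply: continuous_in_subspaceT => x; rewrite inE /= in_itv; exact: cf.
by have [c] := MVT ab dfE' cf'; rewrite in_itv => cab E; exists c.
Qed.

Lemma is_derive_continuous (K : realType) (f : K -> K) (x l : K) :
  is_derive x 1 f l -> {for x, continuous f}.
Proof. by case=> df _; exact/differentiable_continuous/derivable1_diffP. Qed.

Lemma cvg_sumr (K : realType) (T I : Type) (F : set_system T) (r : seq I)
    (f : I -> T -> K) (l : I -> K) : Filter F ->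
  (forall i, f i x @[x --> F] --> l i) ->
  \sum_(i <- r) f i x @[x --> F] --> \sum_(i <- r) l i.
Proof. by move=> FF fl; apply: cvg_big => //; exact: add_continuous. Qed.

Section DoubleJensen.
Variables (K : realType) (M : K) (g theta eta H1 : K -> K).
Hypothesis g_derive : forall y, 0 < y < M -> is_derive y 1 g (theta y).
Hypothesis theta_derive : forall y, 0 < y < M -> is_derive y 1 theta (eta y).
(** Together with [H_tangent], which states strict convexity as a tangent inequality with its
    equality case, this admits vanishing [a i] and [c j]: the point of contact [y] is positive, but
    [z] may be 0. *)
Hypothesis g_cont0 : {for 0, continuous g}.
Let H y := y ^+ 2 * eta y.
Hypothesis H_tangent : forall y z, 0 < y < M -> 0 <= z < M ->
  H y + H1 y * (z - y) <= H z ?= iff (z == y).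

Variables (n : nat) (c : 'I_n -> K) (cb : K).
Hypotheses (c_ge0 : forall j, 0 <= c j) (cb_gt0 : 0 < cb).
Hypothesis c_mean : \sum_j c j = n%:R * cb.

(** [k] is the Jensen difference of [g] at the points [a * c j]; [k1] and [k2] are its first two
    derivatives, and [a ^+ 2 * k2 a] is the Jensen difference of [H]. *)
Let k a := \sum_j (g (a * c j) - g (a * cb)).
Let k1 a := \sum_j (c j * theta (a * c j) - cb * theta (a * cb)).
Let k2 a := \sum_j (c j ^+ 2 * eta (a * c j) - cb ^+ 2 * eta (a * cb)).
Let adm a := (forall j, a * c j < M) /\ a * cb < M.

Lemma adm_le a b : adm b -> a <= b -> adm a.
Proof.
move=> [bc bcb] ab; split => [j|].
  by apply: le_lt_trans (bc j); rewrite ler_wpM2r.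
by apply: le_lt_trans bcb; rewrite ler_wpM2r// ltW.
Qed.

(** The case [d = 0] is separate: the function is then constant, although [f] need not be
    differentiable at 0. *)
Lemma derive_scale (f df : K -> K) a d : 0 < a -> 0 <= d -> a * d < M ->
  (forall y, 0 < y < M -> is_derive y 1 f (df y)) ->
  is_derive a 1 (fun a => f (a * d)) (d * df (a * d)).
Proof.
move=> a0 d0 adM dfE; move: d0; rewrite le_eqVlt => /predU1P[<-|d0].
  rewrite mul0r; have -> : (fun a => f (a * 0)) = cst (f 0).
    by apply/funext => x; rewrite mulr0.
  exact: is_derive_cst.
have ad : is_derive a 1 (fun a : K => a * d) d.
  apply: trigger_derive; rewrite /=. by rewrite scaler0 add0r /GRing.scale /= mulr1.
have dd : is_derive (a * d) 1 f (df (a * d)) by apply: dfE; rewrite adM mulr_gt0.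
by rewrite mulrC; exact: (@is_derive1_comp _ f (fun a : K => a * d) a).
Qed.

Lemma k_derive a : 0 < a -> adm a -> is_derive a 1 k (k1 a).
Proof.
move=> a0 [ac acb]; rewrite /k -fct_sumE; apply: is_derive_sum => j.
apply: is_deriveB; first exact: derive_scale.
by apply: derive_scale => //; exact: ltW.
Qed.

Lemma k1_derive a : 0 < a -> adm a -> is_derive a 1 k1 (k2 a).
Proof.
move=> a0 [ac acb]; rewrite /k1 -fct_sumE; apply: is_derive_sum => j.
have dD d : 0 <= d -> a * d < M ->
    is_derive a 1 (fun a => d * theta (a * d)) (d ^+ 2 * eta (a * d)).
  move=> d0 adM; have ? := derive_scale a0 d0 adM theta_derive.
  by rewrite expr2 -mulrA; apply: is_deriveZ.
by apply: is_deriveB; apply: dD => //; exact: ltW.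
Qed.

Lemma k_cont a : 0 <= a -> adm a -> {for a, continuous k}.
Proof.
move=> a0 [ac acb]; have gc d : 0 <= d -> a * d < M -> {for a, continuous (fun z : K => g (z * d))}.
  move=> d0 adM; have zd : z * d @[z --> a] --> a * d by apply: cvgM; [exact: cvg_id|exact: cvg_cst].
  apply: (cvg_comp _ _ zd); have [->//|ad0] := eqVneq (a * d) 0.
  apply: (is_derive_continuous (g_derive _)); rewrite adM andbT lt_def ad0.
  exact: mulr_ge0.
rewrite /continuous_at; apply: cvg_sumr => j.
by apply: cvgB; apply: gc => //; exact: ltW.
Qed.

(** The first Jensen inequality. Subtracting the tangent of [H] at [a * cb] changes nothing in the
    sum, since the deviations [a * c j - a * cb] add up to 0. *)
Lemma k2_ge0 a : 0 < a -> adm a -> 0 <= k2 a ?= iff [forall j, c j == cb].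
Proof.
move=> a0 [ac acb]; have a2 : 0 < a ^+ 2 by rewrite exprn_gt0.
pose t j := H (a * c j) - H (a * cb) - H1 (a * cb) * (a * c j - a * cb).
have -> : k2 a = a ^- 2 * \sum_j t j.
  have S0 : \sum_j (a * c j - a * cb) = 0.
    rewrite sumrB -mulr_sumr c_mean sumr_const card_ord -(mulr_natl (a * cb)).
    by rewrite mulrCA subrr.
  rewrite /t sumrB -mulr_sumr S0 mulr0 subr0.
  rewrite mulr_sumr /k2; apply: eq_bigr => j _; rewrite /H; field.
  by rewrite gt_eqF.
have tj j : 0 <= t j ?= iff (c j == cb).
  have acbM : 0 < a * cb < M by rewrite acb mulr_gt0.
  have acj : 0 <= a * c j < M by rewrite ac mulr_ge0// ltW.
  have [le eq] := H_tangent acbM acj.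
  have -> : (c j == cb) = (a * c j == a * cb).
    by rewrite (inj_eq (mulfI _))// gt_eqF.
  split; first by rewrite /t; lra.
  rewrite -eq /t; apply/eqP/eqP; lra.
have := leif_sum (fun j (_ : true) => tj j); rewrite big1_eq => -[le eq].
have a2' : 0 < a ^- 2 by rewrite invr_gt0.
split; first by rewrite mulr_ge0// ltW.
by rewrite eq_sym mulf_eq0 gt_eqF//= eq_sym eq.
Qed.

(** Convexity of [k] by two mean values: [p] strictly between [a] and [b], then [q] strictly between
    [p] and [b]. Both are positive even if [a = 0], where [k] is only continuous, and equality
    forces [k2 q = 0]. *)
Lemma k_tangent a b : 0 <= a -> 0 < b -> adm a -> adm b ->
  k b + k1 b * (a - b) <= k a ?= iff ((a == b) || [forall j, c j == cb]).
Proof.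
move=> a0 b0 aa ab.
have [<-|aNb] := eqVneq a b; first by rewrite subrr mulr0 addr0; split; rewrite ?eqxx.
pose lo := Num.min a b; pose hi := Num.max a b.
have lohi : lo < hi by rewrite /lo /hi; case: (ltgtP a b) aNb.
have ahi : adm hi by rewrite /hi; case: (ltP a b).
have lo0 : 0 <= lo by rewrite /lo; case: (ltP a b) => // _; exact: ltW.
have [p /andP[lop phi] kE] := mean_value lohi
  (fun x xlh => @k_derive x (le_lt_trans lo0 (andP xlh).1)
     (adm_le ahi (ltW (andP xlh).2)))
  (fun x xlh => @k_cont x (le_trans lo0 (andP xlh).1) (adm_le ahi (andP xlh).2)).
have p0 : 0 < p by apply: le_lt_trans lop.
have k1E : exists2 q, 0 < q /\ adm q & k1 p - k1 b = k2 q * (p - b).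
  have pb : p != b.
    move: lop phi; rewrite /lo /hi; case: (ltgtP a b) aNb => // _ _ h1 h2.
      by rewrite lt_eqF.
    by rewrite gt_eqF.
  have bhi : b <= hi by rewrite /hi le_max lexx orbT.
  case: (ltP p b) => [pltb|blep].
    have [q /andP[pq qb] E] := mean_value pltb
      (fun x xlh => @k1_derive x (lt_trans p0 (andP xlh).1)
         (adm_le ab (ltW (andP xlh).2)))
      (fun x xlh => is_derive_continuous (@k1_derive x
         (lt_le_trans p0 (andP xlh).1) (adm_le ab (andP xlh).2))).
    exists q; last by move: E; lra.
    by split; [exact: lt_trans pq|exact: adm_le (ltW qb)].
  have bltp : b < p by rewrite lt_def pb.
  have ap : adm p by apply: adm_le ahi (ltW phi).
  have [q /andP[bq qp] E] := mean_value bltp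
    (fun x xlh => @k1_derive x (lt_trans b0 (andP xlh).1)
       (adm_le ap (ltW (andP xlh).2)))
    (fun x xlh => is_derive_continuous (@k1_derive x
       (lt_le_trans b0 (andP xlh).1) (adm_le ap (andP xlh).2))).
  by exists q => //; split; [exact: lt_trans bq|exact: adm_le (ltW qp)].
case: k1E => q [q0 aq] k1E.
have [k2q k2q0] := k2_ge0 q0 aq.
have kE' : k a - k b = k1 p * (a - b).
  move: kE; rewrite /lo /hi; case: (ltgtP a b) aNb => // _ _; lra.
have diff : k a - (k b + k1 b * (a - b)) = k2 q * ((p - b) * (a - b)).
  by rewrite mulrA -k1E; lra.
have pos : 0 < (p - b) * (a - b).
  move: lop phi; rewrite /lo /hi; case: (ltgtP a b) aNb => // _ _ h1 h2; nra.
split; first by rewrite -subr_ge0 diff mulr_ge0// ltW.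
rewrite eq_sym -subr_eq0 diff mulf_eq0 [X in _ || X]gt_eqF// orbF.
by rewrite eq_sym k2q0.
Qed.

(** The second Jensen inequality: the tangents of [k] at [ab] are summed over the [a i], and their
    linear parts cancel. *)
Lemma double_jensen m (a : 'I_m -> K) (ab : K) :
  (forall i, 0 <= a i) -> 0 < ab -> \sum_i a i = m%:R * ab ->
  (forall i j, a i * c j < M) -> (forall i, a i * cb < M) ->
  (forall j, ab * c j < M) -> ab * cb < M ->
  n%:R * (\sum_i g (a i * cb)) + m%:R * (\sum_j g (ab * c j)) -
    (m * n)%:R * g (ab * cb) <= \sum_i \sum_j g (a i * c j)
  ?= iff [forall i, (a i == ab) || [forall j, c j == cb]].
Proof.
move=> a_ge0 ab_gt0 a_mean aiM aicM abcM abM.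
have ki i := k_tangent (a_ge0 i) ab_gt0 (conj (aiM i) (aicM i)) (conj abcM abM).
have := leif_sum (fun i (_ : xpredT i) => ki i).
have kE x : k x = \sum_j g (x * c j) - n%:R * g (x * cb).
  by rewrite /k sumrB sumr_const card_ord -(mulr_natl (g _)).
have -> : \sum_i (k ab + k1 ab * (a i - ab)) = m%:R * k ab.
  rewrite big_split /= sumr_const card_ord -mulr_sumr sumrB a_mean.
  rewrite sumr_const card_ord -(mulr_natl ab) subrr mulr0 addr0.
  by rewrite -[LHS]mulr_natl.
have -> : \sum_i k (a i) = \sum_i \sum_j g (a i * c j) - n%:R * \sum_i g (a i * cb).
  by rewrite mulr_sumr -sumrB; apply: eq_bigr => i _; rewrite kE.
rewrite kE natrM => -[le eq]; split; first by move: le; lra.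
by rewrite -eq; apply/eqP/eqP; lra.
Qed.

End DoubleJensen.

(** * The entropy function *)

(** With [s = sqrt t], the bound [ln s^-1 < s^-1] gives [|t ln t| <= 2 s] for [t] in []0, 1[]; for
    [t <= 0] the logarithm is 0 by convention. *)
Lemma xlnx_cvg0 (K : realType) : {for 0, continuous (fun t : K => t * ln t)}.
Proof.
suff : t * ln t @[t --> (0 : K)] --> (0 : K).
  have {2}-> : (0 : K) = 0 * ln 0 by rewrite mul0r.
  exact.
have s0 : Num.sqrt `|t| + Num.sqrt `|t| @[t --> (0 : K)] --> (0 : K).
  have : Num.sqrt `|t| @[t --> (0 : K)] --> Num.sqrt `|0 : K|.
    apply: (@cvg_comp _ _ _ (fun t : K => `|t|) (@Num.sqrt K) _ (nbhs `|0 : K|)).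
      by apply: cvg_norm; exact: cvg_id.
    exact: sqrt_continuous.
  rewrite normr0 sqrtr0 => h; have := cvgD h h; rewrite addr0. exact.
apply/cvgr0Pnorm_le => /= e e0.
have : \forall t \near (0 : K), Num.sqrt `|t| + Num.sqrt `|t| <= e.
  have /cvgr0Pnorm_le /(_ e e0) := s0; apply: filterS => t.
  by apply: le_trans; exact: ler_norm.
have t1 : \forall t \near (0 : K), `|t| < 1.
  have := @nbhs0_lt K K 1 ltr01; exact.
apply: filterS2 t1 => t t1; apply: le_trans.
case: (leP t 0) => [t0|t0]; first by rewrite ln0// mulr0 normr0 addr_ge0.
move: t1; rewrite gtr0_norm// => t1.
rewrite ler0_norm; last by rewrite mulr_ge0_le0 ?ln_le0 ?ltW.
set s := Num.sqrt t; have s_gt0 : 0 < s by rewrite sqrtr_gt0.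
have tE : t = s ^+ 2 by rewrite sqr_sqrtr// ltW.
have : ln s^-1 < s^-1 by apply: ln_sublinear; rewrite invr_gt0.
rewrite lnV ?posrE// => h.
have h2 : s * - ln s < 1 by rewrite -(mulfV (lt0r_neq0 s_gt0)) ltr_pM2l.
rewrite tE lnXn//; nra.
Qed.

(* [L] is the logarithm of a generating function, [x t = t * L' t] the mean at
   parameter [t], [x1 = x'], [Q = x ^ 2 / (t x')] and [W = dQ / dx].  In terms of
   [y = x t] the entropy has [y ^ 2 g'' y = - Q t], so its strict convexity in
   [y] amounts to [W] being decreasing. *)
Section LegendreTransform.
Variables (K : realType) (t0 : K) (L L1 x x1 Q W : K -> K).
Hypothesis t0_gt0 : 0 < t0.
Hypothesis L_derive : forall t, 0 <= t <= t0 -> is_derive t 1 L (L1 t).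
Hypothesis xE : forall t, 0 <= t <= t0 -> x t = t * L1 t.
Hypothesis L1_cont0 : {for 0, continuous L1}.
Hypothesis x_derive : forall t, 0 <= t <= t0 -> is_derive t 1 x (x1 t).
Hypothesis x1_gt0 : forall t, 0 <= t <= t0 -> 0 < x1 t.
Hypothesis Q_derive : forall t, 0 <= t <= t0 -> is_derive t 1 Q (W t * x1 t).
Hypothesis QE : forall t, 0 <= t <= t0 -> Q t * x1 t = t * L1 t ^+ 2.
Hypothesis W_decr : forall s t, 0 <= s -> s < t -> t <= t0 -> W t < W s.

(* The inverse of [x] on [[0, t0]]; outside the range of [x] it is [0]. *)
Definition tilt y : K := xget 0 [set t | 0 <= t <= t0 /\ x t = y].
(* At [y = 0] this is [L 0 = 0], because [ln 0 = 0]. *)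
Definition entropy y : K := L (tilt y) - y * ln (tilt y).
Let M := x t0.

Lemma zero_in_dom : 0 <= (0 : K) <= t0.
Proof. by rewrite lexx ltW. Qed.

Lemma mean0 : x 0 = 0. Proof. by rewrite xE ?zero_in_dom// mul0r. Qed.

Lemma mean_lt s t : 0 <= s -> s < t -> t <= t0 -> x s < x t.
Proof.
move=> s0 st tt.
have [c /andP[sc ct] E] := mean_value st
  (fun u ust => x_derive (introT andP (conj
     (le_trans s0 (ltW (andP ust).1)) (le_trans (ltW (andP ust).2) tt))))
  (fun u ust => is_derive_continuous (x_derive (introT andP (conj
     (le_trans s0 (andP ust).1) (le_trans (andP ust).2 tt))))).
rewrite -subr_gt0 E mulr_gt0 ?subr_gt0// x1_gt0//.
by rewrite (le_trans s0 (ltW sc)) (le_trans (ltW ct) tt).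
Qed.

Lemma meanK t : 0 <= t <= t0 -> tilt (x t) = t.
Proof.
move=> /andP[t_ge0 tt0]; rewrite /tilt; case: xgetP => [u _ [/andP[u0 ut] E]|].
  by case: (ltgtP u t) => // [/(mean_lt u0)/(_ tt0)|/(mean_lt t_ge0)/(_ ut)];
    rewrite E ltxx.
by move=> /(_ t) []; split => //; apply/andP.
Qed.

Lemma tiltP y : 0 <= y <= M -> 0 <= tilt y <= t0 /\ x (tilt y) = y.
Proof.
move=> yM; have [||c] := @IVT K x 0 t0 y (ltW t0_gt0).
- apply: continuous_in_subspaceT => u; rewrite inE /= in_itv => ut.
  exact: is_derive_continuous (x_derive ut).
- have M0 : x 0 < x t0 by apply: mean_lt.
  by rewrite mean0 in M0 *; rewrite minElt maxElt M0.
by rewrite in_itv => ct <-; rewrite meanK.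
Qed.

Lemma tilt_gt0 y : 0 < y <= M -> 0 < tilt y.
Proof.
move=> /andP[y0 yM]; have [|/andP[T0 _] xT] := @tiltP y; first by rewrite ltW.
by rewrite lt_def T0 andbT; apply: contraTneq y0 => T00; rewrite -xT T00 mean0 ltxx.
Qed.

Lemma tilt_lt y z : 0 <= y -> y < z -> z <= M -> tilt y < tilt z.
Proof.
move=> y0 yz zM.
have [|/andP[Ty0 Tyt] xTy] := @tiltP y; first by rewrite y0 (le_trans (ltW yz)).
have [|/andP[Tz0 Tzt] xTz] := @tiltP z; first by rewrite zM (le_trans y0 (ltW yz)).
rewrite ltNge; apply/negP; rewrite le_eqVlt => /predU1P[E|lt].
  by move: yz; rewrite -xTy -xTz E ltxx.
by have := mean_lt Tz0 lt Tyt; rewrite xTy xTz ltNge ltW.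
Qed.

Lemma tilt_interior y : 0 < y < M -> 0 < tilt y < t0.
Proof.
move=> /andP[y0 yM]; have tM : tilt M = t0 by apply: meanK; rewrite lexx ltW.
rewrite tilt_gt0 ?y0 ?(ltW yM)//= -[X in _ < X]tM.
by apply: tilt_lt => //; exact: ltW.
Qed.

Lemma tilt_derive y : 0 < y < M -> is_derive y 1 tilt (x1 (tilt y))^-1.
Proof.
move=> yM; have /andP[T0 Tt] := tilt_interior yM.
have [|Tdom xT] := @tiltP y; first by case/andP: yM => *; rewrite !ltW.
have near_dom : \forall t \near tilt y, 0 <= t <= t0.
  have := @near_in_itvoo K 0 t0 (tilt y); rewrite in_itv /= T0 Tt => /(_ isT).
  by apply: filterS => t; rewrite in_itv /= => /andP[? ?]; rewrite !ltW.
rewrite -{1}xT; apply: is_derive_inverse; last by rewrite gt_eqF ?x1_gt0.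
- by apply: filterS near_dom => t; exact: meanK.
- by apply: filterS near_dom => t tt; exact: is_derive_continuous (x_derive tt).
exact: x_derive.
Qed.

(** Envelope argument: [y = tilt y * L1 (tilt y)] makes the two terms containing the derivative of
    [tilt] cancel. *)
Lemma entropy_derive y : 0 < y < M -> is_derive y 1 entropy (- ln (tilt y)).
Proof.
move=> yM; have /andP[T0 Tt] := tilt_interior yM.
have Tdom : 0 <= tilt y <= t0 by rewrite !ltW.
have dT := tilt_derive yM.
have dL := @is_derive1_comp _ L tilt y _ _ (L_derive Tdom) dT.
have dl := @is_derive1_comp _ (@ln K) tilt y _ _ (is_derive1_ln T0) dT.
have := is_deriveB dL (is_deriveM (is_derive_id y 1) dl).
have [|_ xT] := @tiltP y; first by case/andP: yM => *; rewrite !ltW.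
have -> : L1 (tilt y) / x1 (tilt y) -
   (y *: ((tilt y)^-1 / x1 (tilt y)) + (@ln K \o tilt) y *: 1) = - ln (tilt y).
  rewrite /GRing.scale /=; have := xT; rewrite xE//; have := x1_gt0 Tdom.
  move: T0; move: (tilt y) => T T0 x1T <-; field.
  by rewrite (gt_eqF T0) gt_eqF.
exact.
Qed.

Lemma entropy_derive2 y : 0 < y < M ->
  is_derive y 1 (fun z => - ln (tilt z)) (- (tilt y * x1 (tilt y))^-1).
Proof.
move=> yM; have /andP[T0 Tt] := tilt_interior yM.
have dl := @is_derive1_comp _ (@ln K) tilt y _ _ (is_derive1_ln T0) (tilt_derive yM).
by have := is_deriveN dl; rewrite invfM.
Qed.

Lemma tilt_cont0 : {for 0, continuous tilt}.
Proof.
have T0 : tilt 0 = 0 by rewrite -{1}mean0 meanK// zero_in_dom.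
change (tilt y @[y --> (0 : K)] --> tilt 0).
rewrite T0; apply/cvgr0Pnorm_lt => e e0.
pose d := Num.min e t0; have d0 : 0 < d by rewrite lt_min e0.
have dt : d <= t0 by rewrite ge_min lexx orbT.
have xd : 0 < x d by rewrite -mean0 mean_lt.
have : \forall y \near (0 : K), `|y| < x d by apply: (@nbhs0_lt K K).
apply: filterS => y yd.
(* Negative [y] are not values of [x], so [tilt] takes its default 0 there; this gives the two-sided
   limit. *)
case: (ltP y 0) => [y0|y0].
  rewrite /tilt; case: xgetP => [u _ [/andP[u0 ut] E]|_]; last by rewrite normr0.
  move: u0; rewrite le_eqVlt => /predU1P[<-|u0]; first by rewrite normr0.
  by move: y0; rewrite -E -mean0 ltNge ltW// mean_lt.
have ydx : y < x d by move: yd; rewrite ger0_norm.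
have xdM : x d <= M.
  by move: dt; rewrite le_eqVlt => /predU1P[->//|dt]; rewrite ltW// mean_lt// ltW.
have [|/andP[Ty0 _] _] := @tiltP y; first by rewrite y0 (le_trans (ltW ydx)).
rewrite ger0_norm//; apply: (@lt_le_trans _ _ d); last by rewrite ge_min lexx.
have tdE : tilt (x d) = d by apply: meanK; rewrite dt ltW.
by rewrite -tdE; apply: tilt_lt.
Qed.

(** Substituting [y = t * L1 t] turns [y ln t] into [(t ln t) * L1 t], which is continuous at 0. *)
Lemma entropy_cont0 : {for 0, continuous entropy}.
Proof.
have T0 : tilt 0 = 0 by rewrite -{1}mean0 meanK// zero_in_dom.
pose F t := L t - (t * ln t) * L1 t.
have F_cont : {for 0, continuous F}.
  apply: cvgB; first exact: is_derive_continuous (L_derive zero_in_dom).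
  by apply: cvgM; [exact: xlnx_cvg0|exact: L1_cont0].
have e0 : entropy 0 = F (tilt 0) by rewrite /entropy /F T0 !mul0r.
change (entropy y @[y --> (0 : K)] --> entropy 0); rewrite e0.
have FT : F (tilt y) @[y --> (0 : K)] --> F (tilt 0).
  by apply: (cvg_comp tilt F); [exact: tilt_cont0|rewrite T0; exact: F_cont].
apply: cvg_trans FT; apply: near_eq_cvg.
have M0 : 0 < M by rewrite -mean0 mean_lt.
have : \forall y \near (0 : K), `|y| < M by apply: (@nbhs0_lt K K).
apply: filterS => y yM; rewrite /F /entropy.
have [y0|y0] := ltP y 0; last first.
  have [|Tdom xT] := @tiltP y; first by rewrite y0 ltW// -[y]ger0_norm.
  by have := xT; rewrite xE//; move: (tilt y) => T <-; ring.
suff -> : tilt y = 0 by rewrite ln0// !mulr0 mul0r.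
rewrite /tilt; case: xgetP => [u _ [/andP[u0 ut] E]|//].
move: u0; rewrite le_eqVlt => /predU1P[//|u0].
by move: y0; rewrite -E -mean0 ltNge ltW// mean_lt.
Qed.

Lemma curvature_tilt y : 0 <= y < M ->
  y ^+ 2 * - (tilt y * x1 (tilt y))^-1 = - Q (tilt y).
Proof.
move=> /andP[y0 yM]; have [|Tdom xT] := @tiltP y; first by rewrite y0 ltW.
have x1T := x1_gt0 Tdom; rewrite mulrN; congr (- _).
rewrite -{1}xT xE//.
have -> : Q (tilt y) = tilt y * L1 (tilt y) ^+ 2 / x1 (tilt y).
  by rewrite -QE// mulfK// gt_eqF.
have [->|T0] := eqVneq (tilt y) 0; first by rewrite !mul0r expr0n /= mul0r.
by field; rewrite T0 gt_eqF.
Qed.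

(** As a function of [x], [Q] has the decreasing derivative [W], so it is strictly concave.
    Concretely, [Q u - W t * x u] increases up to [u = t] and decreases afterwards. *)
Lemma Q_tangent s t : 0 < t < t0 -> 0 <= s <= t0 ->
  Q s <= Q t + W t * (x s - x t) ?= iff (s == t).
Proof.
move=> /andP[tgt0 tt] /andP[s0 st].
have [->|sNt] := eqVneq s t; first by rewrite subrr mulr0 addr0; split; rewrite ?eqxx.
pose lo := Num.min s t; pose hi := Num.max s t.
have lohi : lo < hi by rewrite /lo /hi; case: (ltgtP s t) sNt.
have lo0 : 0 <= lo by rewrite /lo; case: (ltP s t) => // _; exact: ltW.
have hit : hi <= t0 by rewrite /hi; case: (ltP s t) => // _; exact: ltW.
pose f u := Q u - W t * x u.
have f_derive u : 0 <= u <= t0 -> is_derive u 1 f (W u * x1 u - W t * x1 u).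
  move=> ut; apply: is_deriveB; first exact: Q_derive.
  by apply: is_deriveZ; exact: x_derive.
have [c /andP[cl ch] E] := mean_value lohi
  (fun u ust => f_derive u (introT andP (conj
     (le_trans lo0 (ltW (andP ust).1)) (le_trans (ltW (andP ust).2) hit))))
  (fun u ust => is_derive_continuous (f_derive u (introT andP (conj
     (le_trans lo0 (andP ust).1) (le_trans (andP ust).2 hit))))).
have x1c : 0 < x1 c by rewrite x1_gt0// (le_trans lo0 (ltW cl)) (le_trans (ltW ch)).
have : f s < f t.
  move: cl ch E; rewrite /lo /hi; case: (ltgtP s t) sNt => // st' _ cl ch E.
    have Wc : W t < W c by apply: W_decr => //; [exact: le_trans (ltW cl)|exact: ltW].
    by rewrite -subr_gt0 E mulr_gt0 ?subr_gt0// ltr_pM2r.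
  have Wc : W c < W t.
    by apply: W_decr => //; [exact: ltW|exact: le_trans (ltW ch) _].
  by rewrite -subr_lt0 E nmulr_rlt0 ?subr_gt0 ?subr_lt0// ltr_pM2r.
rewrite /f => lt; have lt' : Q s < Q t + W t * (x s - x t) by lra.
by split; [exact: ltW|rewrite lt_eqF].
Qed.

Lemma entropy_tangent y z : 0 < y < M -> 0 <= z < M ->
  y ^+ 2 * - (tilt y * x1 (tilt y))^-1 + - W (tilt y) * (z - y) <=
  z ^+ 2 * - (tilt z * x1 (tilt z))^-1 ?= iff (z == y).
Proof.
move=> yM zM; have /andP[y0 ltyM] := yM; have /andP[z0 ltzM] := zM.
rewrite !curvature_tilt ?z0 ?(ltW y0)//.
have [|Tz xTz] := @tiltP z; first by rewrite z0 ltW.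
have [|Ty xTy] := @tiltP y; first by rewrite !ltW.
have [le eq] := Q_tangent (tilt_interior yM) Tz.
have -> : (z == y) = (tilt z == tilt y).
  by apply/eqP/eqP => [->//|E]; rewrite -xTz -xTy E.
rewrite xTz xTy in le eq.
split; first by lra.
by rewrite -eq; apply/eqP/eqP; lra.
Qed.

Lemma entropy_double_jensen m n (a : 'I_m -> K) (c : 'I_n -> K) (ab cb : K) :
  (forall i, 0 <= a i) -> (forall j, 0 <= c j) -> 0 < ab -> 0 < cb ->
  \sum_i a i = m%:R * ab -> \sum_j c j = n%:R * cb ->
  (forall i j, a i * c j < M) -> (forall i, a i * cb < M) ->
  (forall j, ab * c j < M) -> ab * cb < M ->
  n%:R * (\sum_i entropy (a i * cb)) + m%:R * (\sum_j entropy (ab * c j)) -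
    (m * n)%:R * entropy (ab * cb) <= \sum_i \sum_j entropy (a i * c j)
  ?= iff [forall i, (a i == ab) || [forall j, c j == cb]].
Proof.
move=> a0 c0 ab0 cb0 am cm acM acbM abcM abM.
exact: (double_jensen entropy_derive entropy_derive2 entropy_cont0
  entropy_tangent c0 cb0 cm a0 ab0 am).
Qed.

End LegendreTransform.

(** * The entropy for finite and for unbounded entries *)

Section EntropyFunction.
Variable K : realType.
Implicit Types (t M : K) (kappa : entry_bound).

(* [g] is the entropy exponent of the nomial coefficients on [[0, M[]: it
   satisfies the inequality that makes the independent matrix [a_i c_j] beat
   the independence heuristic. *)
Record entropy_on kappa M (g : K -> K) : Prop := EntropyOn {
  entropy_on0 : g 0 = 0;
  entropy_onE : forall y, 0 < y < M -> exists2 t,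
    0 < t /\ (kappa = None -> t < 1) &
    gen_mean kappa t = y /\ g y = ln (gen kappa t) - y * ln t;
  entropy_on_jensen : forall m n (a : 'I_m -> K) (c : 'I_n -> K) ab cb,
    (forall i, 0 <= a i) -> (forall j, 0 <= c j) -> 0 < ab -> 0 < cb ->
    \sum_i a i = m%:R * ab -> \sum_j c j = n%:R * cb ->
    (forall i j, a i * c j < M) -> (forall i, a i * cb < M) ->
    (forall j, ab * c j < M) -> ab * cb < M ->
    n%:R * (\sum_i g (a i * cb)) + m%:R * (\sum_j g (ab * c j)) -
      (m * n)%:R * g (ab * cb) <= \sum_i \sum_j g (a i * c j)
    ?= iff [forall i, (a i == ab) || [forall j, c j == cb]]
}.

Lemma is_derive_frac (p q : {poly K}) t : q.[t] != 0 ->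
  is_derive t 1 (fun u => p.[u] / q.[u])
    ((p^`().[t] * q.[t] - p.[t] * q^`().[t]) / q.[t] ^+ 2).
Proof.
move=> q0; have dq := is_deriveV q0 (is_derive_poly q t).
have := is_deriveM (is_derive_poly p t) dq.
rewrite /GRing.scale /=.
have -> : p.[t] * (- q.[t] ^- 2 * q^`().[t]) + (q.[t])^-1 * p^`().[t] =
    (p^`().[t] * q.[t] - p.[t] * q^`().[t]) / q.[t] ^+ 2 by field.
exact.
Qed.

Lemma nonneg_neighborhood (p : {poly K}) : 0 < p.[0] ->
  exists2 e, 0 < e & forall t, 0 <= t <= e -> 0 < p.[t].
Proof.
move=> p0; have /cvgrPdist_lt /(_ _ p0) := @continuous_horner K p 0.
move=> /nbhs_ballP [e /= e0 He]; exists (e / 2); first by rewrite divr_gt0.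
move=> t /andP[t0 te]; have := He t; rewrite /ball /= sub0r normrN ger0_norm//.
have -> : t < e by apply: le_lt_trans te _; rewrite ltr_pdivrMr// ltr_pMr// ltr1n.
by move=> /(_ isT); rewrite ltr_norml; lra.
Qed.

Lemma entropy_onP kappa t0 (L1 x1 Q W : K -> K) :
  let L t := ln (gen kappa t) in let x := @gen_mean K kappa in
  0 < t0 -> (kappa = None -> t0 < 1) ->
  (forall t, 0 <= t <= t0 -> is_derive t 1 L (L1 t)) ->
  (forall t, 0 <= t <= t0 -> x t = t * L1 t) ->
  {for 0, continuous L1} ->
  (forall t, 0 <= t <= t0 -> is_derive t 1 x (x1 t)) ->
  (forall t, 0 <= t <= t0 -> 0 < x1 t) ->
  (forall t, 0 <= t <= t0 -> is_derive t 1 Q (W t * x1 t)) ->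
  (forall t, 0 <= t <= t0 -> Q t * x1 t = t * L1 t ^+ 2) ->
  (forall s t, 0 <= s -> s < t -> t <= t0 -> W t < W s) ->
  L 0 = 0 ->
  entropy_on kappa (x t0) (entropy t0 L x).
Proof.
move=> L x t0_gt0 t0_lt1 dL xE cL1 dx x1_gt0 dQ QE dW L0.
have h0 : 0 <= (0 : K) <= t0 by rewrite lexx ltW.
have x0 : x 0 = 0 by rewrite xE// mul0r.
split.
- by rewrite /entropy -{1}x0 (meanK dx x1_gt0)// L0 mul0r subr0.
- move=> y /andP[y0 yM]; have y0M : 0 <= y <= x t0 by rewrite !ltW.
  have [/andP[_ Tt] xT] := tiltP t0_gt0 xE dx x1_gt0 y0M.
  exists (tilt t0 x y) => //; split.
    by apply: (tilt_gt0 t0_gt0 xE dx x1_gt0); rewrite y0 ltW.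
  by move=> /t0_lt1; exact: le_lt_trans.
- exact: (entropy_double_jensen t0_gt0 dL xE cL1 dx x1_gt0 dQ QE dW).
Qed.

(** At 0 one has [W' = E 0 = 2 - 2 Z''(0)], and [k >= 2] enters through [Z''(0) = 2]. The value
    [- 2] is that of the unbounded case, where [W = (1 - t) ^+ 2]; for [k = 1] it would be [+ 2]. By
    continuity [W] still decreases on some [[0, t0]], and [M] is the mean at [t0]. *)
Lemma entropy_on_fin k : (2 <= k)%N ->
  exists2 M, 0 < M & exists g, entropy_on (Some k) M g.
Proof.
move=> k2; pose Z : {poly K} := \poly_(i < k.+1) 1.
(* The existentials keep the polynomials opaque, with their equations at hand for rewriting. *)
pose Z1 := Z^`(); have [P PE] : exists P, P = 'X * Z1 by eexists.
(* [x = P / Z], [x' = D / Z ^ 2], [Q = S / D] and [W = N Z ^ 2 / D ^ 3], with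
   [W' = E / D ^ 4] and [E 0 = - 2]. *)
have [D DE] : exists D, D = P^`() * Z - P * Z1 by eexists.
have [S SE] : exists S, S = 'X * Z1 ^+ 2 by eexists.
have [N NE] : exists N, N = S^`() * D - S * D^`() by eexists.
have [E EE] : exists E, E = (N * Z ^+ 2)^`() * D - (N * Z ^+ 2 * D^`()) *+ 3.
  by eexists.
have Z0 : Z.[0] = 1 by rewrite horner_coef0 coef_poly.
have Z10 : Z1.[0] = 1.
  by rewrite horner_coef0 coef_deriv coef_poly ltnS ltnW.
have Z20 : Z1^`().[0] = 2.
  by rewrite horner_coef0 !coef_deriv coef_poly ltnS k2.
have [P0 [P1 P2]] : P.[0] = 0 /\ P^`().[0] = 1 /\ P^`()^`().[0] = 4.
  rewrite PE !(derivM, derivD, derivX, derivC) !hornerE Z10 Z20 /=.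
  by split=> //; split; ring.
have [S0 [S1 S2]] : S.[0] = 0 /\ S^`().[0] = 1 /\ S^`()^`().[0] = 8.
  rewrite SE expr2 !(derivM, derivD, derivX, derivC) !hornerE Z10 Z20 /=.
  by split=> //; split; ring.
have D0 : D.[0] = 1 by rewrite DE !hornerE P0 P1 Z0 /=; ring.
have D1 : D^`().[0] = 4.
  by rewrite DE derivB !derivM -/Z1 !hornerE P0 P1 P2 Z0 Z10 /=; ring.
have N0 : N.[0] = 1 by rewrite NE !hornerE S0 S1 D0 /=; ring.
have N1 : N^`().[0] = 8.
  by rewrite NE derivB !derivM !hornerE S0 S1 S2 D0 D1 /=; ring.
have E0 : E.[0] = - 2.
  rewrite EE expr2 !derivM -/Z1 hornerD hornerN hornerMn !hornerE.
  by rewrite N0 N1 D0 D1 Z0 Z10 /=; ring.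
have genE t : gen (Some k) t = Z.[t].
  rewrite (horner_coef_wide _ (size_poly _ _)); apply: eq_bigr => i _.
  by rewrite coef_poly ltn_ord mul1r.
have gen_pos t : 0 <= t -> 0 < Z.[t].
  rewrite le_eqVlt => /predU1P[<-|t0]; first by rewrite Z0.
  by rewrite -genE gen_fin_gt0.
have meanE t : gen_mean (Some k) t = P.[t] / Z.[t].
  rewrite /gen_mean genE; congr (_ / _).
  have Z1E : Z1 = \sum_(i < k.+1) 'X^(i.-1) *+ i.
    rewrite /Z1 /Z poly_def raddf_sum /=; apply: eq_bigr => i _.
    by rewrite scale1r derivXn.
  rewrite PE hornerM hornerX Z1E horner_sum mulr_sumr; apply: eq_bigr => i _.
  rewrite hornerMn hornerXn; case: i => -[|i] ik /=.
    by rewrite mul0r mulr0n mulr0.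
  by rewrite -[in RHS](mulr_natl (t ^+ i)) mulrCA -exprS.
have [e1 e1_gt0 De] : exists2 e, 0 < e & forall t, 0 <= t <= e -> 0 < D.[t].
  by apply: nonneg_neighborhood; rewrite D0.
have [e2 e2_gt0 Ee] : exists2 e, 0 < e & forall t, 0 <= t <= e -> 0 < (- E).[t].
  by apply: nonneg_neighborhood; rewrite hornerN E0 opprK.
pose t0 := Num.min e1 e2; have t0_gt0 : 0 < t0 by rewrite lt_min e1_gt0.
have D_gt0 t : 0 <= t <= t0 -> 0 < D.[t].
  by move=> /andP[t_ge0]; rewrite le_min => /andP[te _]; rewrite De// t_ge0.
have E_lt0 t : 0 <= t <= t0 -> E.[t] < 0.
  move=> /andP[t_ge0]; rewrite le_min => /andP[_ te].
  by rewrite -oppr_gt0 -hornerN Ee// t_ge0.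
have Z_gt0 t : 0 <= t <= t0 -> 0 < Z.[t] by case/andP=> + _; exact: gen_pos.
pose L t := ln (gen (Some k) t); pose L1 t := Z1.[t] / Z.[t].
pose x := @gen_mean K (Some k); pose x1 t := D.[t] / Z.[t] ^+ 2.
pose Q t := S.[t] / D.[t].
pose W t := (N * Z ^+ 2).[t] / (D ^+ 3).[t].
have L_derive t : 0 <= t <= t0 -> is_derive t 1 L (L1 t).
  move=> tt; have -> : L = @ln K \o horner Z by apply/funext => u; rewrite /L genE.
  rewrite /L1 mulrC; apply: is_derive1_comp.
  by apply: is_derive1_ln; exact: Z_gt0.
have xE t : 0 <= t <= t0 -> x t = t * L1 t.
  by move=> _; rewrite /x meanE PE hornerM hornerX mulrA.
have L1_cont0 : {for 0, continuous L1}.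
  by apply: is_derive_continuous; apply: is_derive_frac; rewrite Z0 oner_neq0.
have x_derive t : 0 <= t <= t0 -> is_derive t 1 x (x1 t).
  move=> tt; have -> : x = (fun u => P.[u] / Z.[u]) by apply/funext.
  rewrite /x1 DE hornerD hornerN !hornerM.
  by have := @is_derive_frac P Z t (lt0r_neq0 (Z_gt0 _ tt)).
have x1_gt0 t : 0 <= t <= t0 -> 0 < x1 t.
  by move=> tt; rewrite divr_gt0 ?exprn_gt0 ?D_gt0 ?Z_gt0.
have Q_derive t : 0 <= t <= t0 -> is_derive t 1 Q (W t * x1 t).
  move=> tt; have D0t := lt0r_neq0 (D_gt0 _ tt).
  have Z0t := lt0r_neq0 (Z_gt0 _ tt).
  have -> : W t * x1 t = (S^`().[t] * D.[t] - S.[t] * D^`().[t]) / D.[t] ^+ 2.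
    rewrite /W /x1 NE !(hornerM, hornerD, hornerN, horner_exp).
    move: S^`().[t] S.[t] D^`().[t] D.[t] Z.[t] D0t Z0t => ? ? ? d z d0 z0.
    by field; rewrite d0 z0.
  exact: is_derive_frac.
have QE t : 0 <= t <= t0 -> Q t * x1 t = t * L1 t ^+ 2.
  move=> tt; have D0t := lt0r_neq0 (D_gt0 _ tt).
  have Z0t := lt0r_neq0 (Z_gt0 _ tt).
  rewrite /Q /x1 /L1 SE hornerM hornerX horner_exp.
  move: Z1.[t] D.[t] Z.[t] D0t Z0t => ? d z d0 z0.
  by field; rewrite d0 z0.
have W_derive t : 0 <= t <= t0 -> is_derive t 1 W (E.[t] / D.[t] ^+ 4).
  move=> tt; have D0t := lt0r_neq0 (D_gt0 _ tt).
  have D3t : (D ^+ 3).[t] != 0 by rewrite horner_exp expf_neq0.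
  have := @is_derive_frac (N * Z ^+ 2) (D ^+ 3) t D3t.
  have -> : ((N * Z ^+ 2)^`().[t] * (D ^+ 3).[t] -
     (N * Z ^+ 2).[t] * (D ^+ 3)^`().[t]) / (D ^+ 3).[t] ^+ 2 = E.[t] / D.[t] ^+ 4.
    rewrite EE; move: (N * Z ^+ 2) => F.
    rewrite deriv_exp !(hornerM, hornerD, hornerN, horner_exp, hornerMn) /=.
    move: F.[t] F^`().[t] D^`().[t] D.[t] D0t => ? ? ? d d0.
    by field.
  exact.
have W_decr s t : 0 <= s -> s < t -> t <= t0 -> W t < W s.
  move=> s0 st tt.
  have dom u : s <= u <= t -> 0 <= u <= t0.
    by move=> /andP[su ut]; rewrite (le_trans s0 su) (le_trans ut tt).
  have [c /andP[sc ct] WE] := mean_value st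
    (fun u ust => W_derive u (dom u (introT andP
      (conj (ltW (andP ust).1) (ltW (andP ust).2)))))
    (fun u ust => is_derive_continuous (W_derive u (dom u ust))).
  have cd : 0 <= c <= t0 by apply: dom; rewrite !ltW.
  rewrite -subr_lt0 WE pmulr_llt0 ?subr_gt0// pmulr_llt0 ?E_lt0//.
  by rewrite invr_gt0 exprn_gt0// D_gt0.
have L0 : L 0 = 0 by rewrite /L genE Z0 ln1.
have x0 : x 0 = 0 by rewrite xE ?mul0r// lexx ltW.
exists (x t0); first by rewrite -x0; apply: (mean_lt x_derive x1_gt0).
exists (entropy t0 L x).
exact: (entropy_onP t0_gt0 _ L_derive xE L1_cont0 x_derive x1_gt0 Q_derive
  QE W_decr L0).
Qed.

(** Everything is explicit: [x = t / (1 - t)], [Q = t = x / (1 + x)], [W = (1 - t) ^+ 2], and [W]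
    decreases up to 1. The endpoint [t0] solves [x t0 = |M| + 1]. *)
Lemma entropy_on_oo M : exists g, entropy_on None M g.
Proof.
pose M1 := `|M| + 1; have M1_gt0 : 0 < M1 by rewrite ltr_wpDl.
pose t0 := M1 / (1 + M1).
have t0_gt0 : 0 < t0 by rewrite divr_gt0// addr_gt0.
have M2_gt0 : 0 < 1 + M1 by rewrite addr_gt0.
have t0_lt1 : t0 < 1 by rewrite /t0 (ltr_pdivrMr _ _ M2_gt0) mul1r ltrDr.
have sub_gt0 t : 0 <= t <= t0 -> 0 < 1 - t.
  by move=> /andP[_ tt]; rewrite subr_gt0 (le_lt_trans tt).
pose d : {poly K} := 1 - 'X.
have dE t : d.[t] = 1 - t by rewrite /d !hornerE.
have d'E : d^`() = - 1 by rewrite /d derivB derivX derivC sub0r.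
have d0 t : 0 <= t <= t0 -> d.[t] != 0.
  by move=> tt; rewrite dE (lt0r_neq0 (sub_gt0 _ tt)).
pose L t := ln (gen None t); pose L1 t := (1 - t)^-1.
pose x := @gen_mean K None; pose x1 t := (1 - t) ^- 2.
pose Q t : K := t; pose W t := (1 - t) ^+ 2.
have L_derive t : 0 <= t <= t0 -> is_derive t 1 L (L1 t).
  move=> tt; have := is_deriveV (d0 _ tt) (is_derive_poly d t).
  have Lp : 0 < (d.[t])^-1 by rewrite invr_gt0 dE sub_gt0.
  move=> dV; have := @is_derive1_comp _ (@ln K) (fun y => (d.[y])^-1) t _ _
    (is_derive1_ln Lp) dV.
  have -> : L = @ln K \o (fun y => (d.[y])^-1).
    by apply/funext => u; rewrite /L /= dE.
  rewrite d'E hornerN hornerC dE invrK /L1 /GRing.scale /= mulrN1 opprK.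
  have -> // : (1 - t) * (1 - t) ^- 2 = (1 - t)^-1.
  by field; rewrite -dE d0.
have xE t : 0 <= t <= t0 -> x t = t * L1 t by [].
have L1_cont0 : {for 0, continuous L1}.
  have h0 : 0 <= (0 : K) <= t0 by rewrite lexx ltW.
  have -> : L1 = fun y => (d.[y])^-1 by apply/funext => u; rewrite /L1 dE.
  exact: is_derive_continuous (is_deriveV (d0 _ h0) (is_derive_poly d 0)).
have x_derive t : 0 <= t <= t0 -> is_derive t 1 x (x1 t).
  move=> tt; have := is_derive_frac 'X (d0 _ tt).
  have -> : x = (fun u => 'X.[u] / d.[u]).
    by apply/funext => u; rewrite hornerX dE.
  move=> /trigger_derive; apply; rewrite derivX d'E !hornerE /x1.
  by field; rewrite -dE d0.
have x1_gt0 t : 0 <= t <= t0 -> 0 < x1 t.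
  by move=> tt; rewrite invr_gt0 exprn_gt0// sub_gt0.
have Q_derive t : 0 <= t <= t0 -> is_derive t 1 Q (W t * x1 t).
  move=> tt; rewrite mulfV; first exact: is_derive_id.
  by rewrite expf_neq0// -dE d0.
have QE t : 0 <= t <= t0 -> Q t * x1 t = t * L1 t ^+ 2.
  by move=> _; rewrite /Q /x1 /L1 exprVn.
have W_decr s t : 0 <= s -> s < t -> t <= t0 -> W t < W s.
  move=> s0 st tt; rewrite /W ltr_pXn2r// ?nnegrE.
  - by rewrite ltrD2l ltrN2.
  - by rewrite ltW// sub_gt0// tt (le_trans s0 (ltW st)).
  by rewrite ltW// sub_gt0// s0 (le_trans (ltW st)).
have L0 : L 0 = 0 by rewrite /L /= subr0 invr1 ln1.
exists (entropy t0 L x).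
have [g0 gE gJ] := entropy_onP t0_gt0 (fun _ => t0_lt1) L_derive xE L1_cont0
  x_derive x1_gt0 Q_derive QE W_decr L0.
have Mx y : y < M -> y < x t0.
  move=> yM; apply: lt_le_trans yM _.
  have -> : x t0 = M1.
    have E : 1 - t0 = (1 + M1)^-1.
      by rewrite /t0 -[X in X - _](divff (lt0r_neq0 M2_gt0)) -mulrBl addrK mul1r.
    by rewrite /x /= E invrK divfK// gt_eqF.
  by rewrite (le_trans (ler_norm M))// lerDl.
split=> // [y /andP[y0 /Mx yM]|]; first by apply: gE; rewrite y0.
by move=> m n a c ab cb a0 c0 ab0 cb0 am cm acM acb abc abcb; apply: gJ => // *; exact: Mx.
Qed.

End EntropyFunction.

(** * Limits *)

Section Limits.
Variable K : realType.

Lemma ln_prodr (I : Type) (r : seq I) (F : I -> K) : (forall i, 0 < F i) ->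
  ln (\prod_(i <- r) F i) = \sum_(i <- r) ln (F i).
Proof.
move=> F0; elim: r => [|x r IH]; first by rewrite !big_nil ln1.
by rewrite !big_cons lnM ?posrE ?prodr_gt0// IH.
Qed.

(** The limit is the supremum. If [s] nearly attains it and [k = n %/ s], then
    [u n >= u (k * s) >= k ^ 2 * u s] with [k * s >= n - s], which loses at most [2 s D / n] after
    normalization. *)
Lemma fekete_square (u : nat -> K) (D : K) :
  (forall s, 0 <= u s) -> (forall s, u s <= u s.+1) ->
  (forall k s, (k ^ 2)%:R * u s <= u (k * s)%N) ->
  (forall s, u s <= (s ^ 2)%:R * D) ->
  exists2 l, (s%:R ^+ 2)^-1 * u s @[s --> \oo] --> l &
    forall s, (s%:R ^+ 2)^-1 * u s <= l.
Proof.
move=> u0 u_incr u_mul u_bnd; pose v s := (s%:R ^+ 2)^-1 * u s.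
have vD s : (0 < s)%N -> v s <= D.
  move=> s0; rewrite /v mulrC ler_pdivrMr ?exprn_gt0 ?ltr0n//.
  by rewrite mulrC -natrX.
have D0 : 0 <= D by have := le_trans (u0 1%N) (u_bnd 1%N); rewrite mul1r.
have v0 : v 0%N = 0 by rewrite /v expr0n /= invr0 mul0r.
have hs : has_sup (range v).
  split; first by exists (v 0%N); exists 0%N.
  by exists D => _ [s _ <-]; case: s => [|s]; [rewrite v0|exact: vD].
have v_sup s : v s <= sup (range v) by apply: ub_le_sup; [exact: hs.2|exists s].
exists (sup (range v)) => //; apply/cvgrPdist_le => e e0.
have e2 : 0 < e / 2 by rewrite divr_gt0.
have [_ [s _ <-]] := sup_adherent e2 hs; set l := sup _ => ls.
(* Order 0 has value 0 because [0^-1 = 0]; if it is nearly optimal, all values lie between 0 and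
   [e / 2]. *)
move: ls; case: s => [|s] ls.
  exists 0%N => // n _ /=; rewrite -/(v n) ger0_norm ?subr_ge0 ?v_sup//.
  have vn0 : 0 <= v n by rewrite mulr_ge0// invr_ge0 exprn_ge0.
  rewrite v0 in ls; lra.
have u_mono a b : (a <= b)%N -> u a <= u b.
  by move=> /subnKC <-; elim: (b - a)%N => [|d IH];
    rewrite ?addn0// addnS (le_trans IH).
pose N := (Num.truncn (4 * s.+1%:R * D / e)).+1.
exists (maxn N s.+1) => // n /=; rewrite geq_max => /andP[Nn sn].
rewrite -/(v n) ger0_norm ?subr_ge0 ?v_sup//.
have n0 : 0 < n%:R :> K by rewrite ltr0n (leq_trans _ sn).
have s0 : 0 < s.+1%:R :> K by rewrite ltr0n.
pose k := (n %/ s.+1)%N.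
have un : (k ^ 2)%:R * u s.+1 <= u n.
  by apply: le_trans (u_mul _ _) (u_mono _ _ _); exact: leq_trunc_div.
have kn : (n < k.+1 * s.+1)%N by rewrite ltn_ceil.
have small : 4 * s.+1%:R * D / e < n%:R.
  apply: lt_le_trans (truncnS_gt _) _; last by rewrite ler_nat.
have us : u s.+1 = s.+1%:R ^+ 2 * v s.+1.
  by rewrite /v mulrA mulfV ?mul1r// expf_neq0// gt_eqF.
have vs0 : 0 <= v s.+1 by rewrite mulr_ge0// invr_ge0 exprn_ge0.
have key : v s.+1 - 2 * s.+1%:R * D / n%:R <= v n.
  have ks : n%:R - s.+1%:R <= k%:R * s.+1%:R :> K.
    by rewrite lerBlDr -natrM -natrD ler_nat addnC -mulSn ltnW.
  have ns : 0 <= n%:R - s.+1%:R :> K by rewrite subr_ge0 ler_nat.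
  have sq : (n%:R - s.+1%:R) ^+ 2 <= (k%:R * s.+1%:R) ^+ 2 :> K.
    by rewrite lerXn2r// nnegrE// mulr_ge0.
  have h : (n%:R - s.+1%:R) ^+ 2 * v s.+1 <= u n.
    apply: le_trans un; rewrite us natrX [leRHS]mulrA -exprMn.
    exact: ler_wpM2r.
  have -> : v n = u n / n%:R ^+ 2 by rewrite /v mulrC.
  rewrite ler_pdivlMr ?exprn_gt0//; apply: le_trans h.
  have -> : (v s.+1 - 2 * s.+1%:R * D / n%:R) * n%:R ^+ 2 =
    v s.+1 * n%:R ^+ 2 - 2 * s.+1%:R * D * n%:R by field; rewrite gt_eqF.
  have h3 : n%:R * s.+1%:R * v s.+1 <= n%:R * s.+1%:R * D.
    by rewrite ler_wpM2l ?vD// mulr_ge0// ltW.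
  have h4 : 0 <= s.+1%:R ^+ 2 * v s.+1 by rewrite mulr_ge0// exprn_ge0// ltW.
  move: h3 h4; move: (v s.+1) (n%:R) (s.+1%:R) => V x y; nra.
have : 2 * s.+1%:R * D / n%:R <= e / 2.
  rewrite ler_pdivrMr//; move: small; rewrite ltr_pdivrMr//; nra.
lra.
Qed.

Definition slack (a : nat) (s : nat) : K := ln (a * s.+1).+1%:R / s.+1%:R.

(** Follows from [ln p <= 2 sqrt p], which is [ln_sublinear] at [sqrt p], and [p <= a.+1 * s.+1]. *)
Lemma slack_cvg0 a : slack a s @[s --> \oo] --> (0 : K).
Proof.
have h : (a.+1%:R : K) * harmonic s @[s --> \oo] --> (0 : K).
  by rewrite -[X in _ --> X](mulr0 (a.+1%:R : K)); apply: cvgM;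
    [exact: cvg_cst|exact: cvg_harmonic].
have h2 : 2 * Num.sqrt (a.+1%:R * harmonic s) @[s --> \oo] --> (0 : K).
  rewrite -[X in _ --> X](mulr0 (2 : K)); apply: cvgM; first exact: cvg_cst.
  rewrite -[X in _ --> X](@sqrtr0 K).
  by apply: (cvg_comp _ _ h); exact: sqrt_continuous.
apply: (squeeze_cvgr _ (cvg_cst 0) h2); apply: nearW => s.
have p0 : 0 < (a * s.+1).+1%:R :> K by rewrite ltr0n.
have s0 : 0 < s.+1%:R :> K by rewrite ltr0n.
rewrite /slack divr_ge0 ?ln_ge0 ?ler1n//= ler_pdivrMr//.
set p := (a * s.+1).+1%:R in p0 *.
have r0 : 0 < Num.sqrt p by rewrite sqrtr_gt0.
have lnp : ln p <= 2 * Num.sqrt p.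
  rewrite -{1}(sqr_sqrtr (ltW p0)) lnXn// mulr_natl lerMn2r /=.
  by rewrite ltW// ln_sublinear.
apply: le_trans lnp _; rewrite -mulrA ler_wpM2l//.
rewrite -[X in _ <= _ * X](ger0_norm (ltW s0)) -[X in _ <= _ * X]sqrtr_sqr -sqrtrM; last by rewrite mulr_ge0// harmonic_ge0.
rewrite ler_wsqrtr// /p.
have -> : (a.+1%:R : K) * harmonic s * s.+1%:R ^+ 2 = (a.+1 * s.+1)%:R.
  by rewrite /harmonic /= natrM; field; rewrite gt_eqF.
by rewrite ler_nat mulSn; lia.
Qed.

(* Polynomial factors are at most a multiple of [slack] in the exponent. *)
Lemma ln_sqr_slack a s : ln (a * s.+1 ^ 2).+1%:R <= 2 * s.+1%:R * slack a.+1 s.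
Proof.
have s0 : 0 < s.+1%:R :> K by rewrite ltr0n.
have -> : 2 * s.+1%:R * slack a.+1 s = ln ((a.+1 * s.+1).+1 ^ 2)%:R.
  by rewrite natrX lnXn ?ltr0n// /slack; field; rewrite gt_eqF.
rewrite ler_ln ?posrE ?ltr0n// ?expn_gt0// ler_nat; nia.
Qed.

Variables (kappa : entry_bound) (M : K) (g : K -> K).
Hypotheses (kappa1 : leq_entry_bound 1%N kappa) (gP : entropy_on kappa M g).

(** Both generating function bounds are taken at the parameter with mean [r / n]. The case [r = 0]
    is apart, since [gP] supplies a parameter only for positive means. *)
Lemma nomial_entropy_bounds n r : (0 < n)%N -> r%:R / n%:R < M ->
  (0 < nomial kappa n r)%N /\
  n%:R * g (r%:R / n%:R) - ln (prefactor kappa n r)%:R <=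
    ln (nomial kappa n r)%:R <= n%:R * g (r%:R / n%:R).
Proof.
move=> n0 rM; have n0' : 0 < n%:R :> K by rewrite ltr0n.
have pf0 : 0 < (prefactor kappa n r)%:R :> K by rewrite ltr0n expn_gt0.
have pf1 : 0 <= ln (prefactor kappa n r)%:R :> K by rewrite ln_ge0// ler1n expn_gt0.
move: rM pf0 pf1; case: r => [|r] rM pf0 pf1.
  by rewrite nomial_r0 ln1 mul0r (entropy_on0 gP) mulr0 sub0r lexx oppr_le0 pf1.
have [|t [t0 t1] [mt gt]] := @entropy_onE _ _ _ _ gP (r.+1%:R / n%:R).
  by rewrite rM divr_gt0// ltr0n.
have Z0 := gen_gt0 t0 t1.
have mt' : gen_mean kappa t * n%:R = r.+1%:R by rewrite mt divfK// gt_eqF.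
have lo := gen_le_nomial kappa1 t0 t1 n0 mt'.
have hi := nomial_le_gen n r.+1 t0 t1.
have Zn : 0 < gen kappa t ^+ n by rewrite exprn_gt0.
have tr : 0 < t ^+ r.+1 by rewrite exprn_gt0.
have nom0 : (0 < nomial kappa n r.+1)%N.
  rewrite lt0n; apply: contraTneq lo => ->.
  by rewrite mul0r mulr0 -ltNge.
have nom0' : 0 < (nomial kappa n r.+1)%:R :> K by rewrite ltr0n.
have ngE : n%:R * g (r.+1%:R / n%:R) = ln (gen kappa t ^+ n) - ln (t ^+ r.+1).
  rewrite gt !lnXn// -(mulr_natl (ln t)) -(mulr_natl (ln (gen kappa t))).
  by field; rewrite gt_eqF.
split=> //; rewrite ngE; apply/andP; split.
  rewrite lerBlDr lerBlDr -!lnM ?posrE ?mulr_gt0// ler_ln ?posrE ?mulr_gt0//.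
  by apply: le_trans lo _; rewrite le_eqVlt; apply/predU1P; left; ring.
by rewrite lerBrDr -lnM ?posrE// ler_ln ?posrE ?mulr_gt0.
Qed.

Lemma ln_prefactor_slack s q p a : (odflt 1%N kappa * q + p <= a)%N ->
  ln (prefactor kappa (s.+1 ^ 2 * q) (s.+1 ^ 2 * p))%:R <=
  4 * s.+1%:R * slack a.+1 s.
Proof.
move=> qpa; rewrite natrX lnXn ?ltr0n//.
have -> : 4 * s.+1%:R * slack a.+1 s = (2 * s.+1%:R * slack a.+1 s) *+ 2 by ring.
rewrite lerMn2r /=; apply: le_trans (ln_sqr_slack a s).
rewrite ler_ln ?posrE ?ltr0n// ler_nat ltnS mulnCA -mulnDr mulnC.
by rewrite leq_mul2r qpa orbT.
Qed.

Lemma nomial_cvg q p : (0 < q)%N -> p%:R / q%:R < M ->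
  s.+1%:R^-1 * ln (nomial kappa (s.+1 * q) (s.+1 * p))%:R @[s --> \oo] -->
  q%:R * g (p%:R / q%:R).
Proof.
move=> q0 pqM; set l := q%:R * _.
pose a := (odflt 1%N kappa * q + p)%N.
have lo : l - 2 * slack a s @[s --> \oo] --> l.
  rewrite -[X in _ --> X]subr0 -[X in _ - X](mulr0 2).
  apply: cvgB; first exact: cvg_cst.
  by apply: cvgM; [exact: cvg_cst|exact: slack_cvg0].
apply: (squeeze_cvgr _ lo (cvg_cst l)); apply: nearW => s.
have s0 : 0 < s.+1%:R :> K by rewrite ltr0n.
have q0' : 0 < q%:R :> K by rewrite ltr0n.
have E : (s.+1 * p)%:R / (s.+1 * q)%:R = p%:R / q%:R :> K.
  by rewrite !natrM; field; rewrite !gt_eqF.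
have := @nomial_entropy_bounds (s.+1 * q) (s.+1 * p).
rewrite E muln_gt0 q0 => /(_ isT pqM)[_ /andP[h1 h2]].
rewrite [X in _ <= X <= _]mulrC ler_pdivlMr// ler_pdivrMr//; apply/andP; split; last first.
  by apply: le_trans h2 _; rewrite natrM /l le_eqVlt; apply/predU1P; left; ring.
apply: le_trans h1; rewrite natrM natrX lnXn ?ltr0n//.
rewrite mulnCA -mulnDr mulnC -/a le_eqVlt; apply/predU1P; left.
by rewrite /slack /l; field; rewrite gt_eqF.
Qed.

Lemma nomial_cvg_sqr q p : (0 < q)%N -> p%:R / q%:R < M ->
  (s.+1%:R ^+ 2)^-1 * ln (nomial kappa (s.+1 ^ 2 * q) (s.+1 ^ 2 * p))%:R
    @[s --> \oo] --> q%:R * g (p%:R / q%:R).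
Proof.
move=> q0 pqM; have := nomial_cvg q0 pqM; set F := fun s : nat => _ => FE.
have hoo : ((s.+1 ^ 2).-1)%N @[s --> \oo] --> \oo.
  apply/cvgnyPge => A; exists A => // s As; have {}As : (A <= s)%N by [].
  by move: (s.+1 ^ 2)%N (leq_pexp2l (isT : (0 < s.+1)%N) (isT : (1 <= 2)%N)); lia.
have := cvg_comp _ _ hoo FE; apply: cvg_trans; apply: near_eq_cvg.
apply: nearW => s; rewrite -natrX /F /=.
have -> : ((s.+1 ^ 2).-1.+1 = s.+1 ^ 2)%N by rewrite prednK ?expn_gt0.
by [].
Qed.

End Limits.

Lemma size_clone s R : size (clone s R) = (s * size R)%N.
Proof. by rewrite size_flatten /shape map_nseq size_map sumn_nseq mulnC. Qed.

Lemma clone1 R : clone 1 R = R.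
Proof. by rewrite /clone /= cats0 -[RHS]map_id; apply: eq_map => x; rewrite mul1n. Qed.

Lemma prod_clone (K : realType) m (R : m.-tuple nat) s (F : nat -> K) :
  \prod_(r <- clone s R) F r = (\prod_i F (s * tnth R i)%N) ^+ s.
Proof.
rewrite -(big_tuple _ _ _ xpredT (fun r => F (s * r)%N)).
have -> : \prod_(r <- R) F (s * r)%N = \prod_(r <- [seq (s * r)%N | r <- R]) F r.
  by rewrite big_map.
rewrite /clone; move: [seq _ | r <- R] => l; elim: s => [|k IH] /=.
  by rewrite big_nil.
by rewrite big_cat IH exprS.
Qed.

(** * Existence of the transport limit *)

Section Transport.
Variables (K : realType) (kappa : entry_bound) (m n : nat).
Variables (R : m.-tuple nat) (C : n.-tuple nat).
Hypothesis T_gt0 : (0 < num_transport kappa R C)%N.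

Let T s := num_transport kappa (clone s R) (clone s C).

Lemma num_transport_clone_gt0 s : (0 < T s)%N.
Proof.
have := num_transport_clone_mul kappa R C s 1; rewrite muln1 !clone1.
by apply: leq_trans; rewrite expn_gt0 T_gt0.
Qed.

Lemma log_transport_cvg :
  exists2 l, log_transport K kappa R C s @[s --> \oo] --> l &
    forall s, log_transport K kappa R C s <= l.
Proof.
(* Any parameter in []0, 1[] would do: it serves only for the upper bound of order [s ^ 2] on
   [ln (T s)]. *)
pose h : K := 2^-1; have h0 : 0 < h by rewrite invr_gt0.
have h1 : kappa = None -> h < 1 by move=> _; rewrite invf_lt1// ltr1n.
apply: (@fekete_square K (fun s => ln (T s)%:R)
   ((m * n)%:R * ln (gen kappa h) - (sumn R)%:R * ln h)).
- by move=> s; rewrite ln_ge0// ler1n num_transport_clone_gt0.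
- move=> s; rewrite ler_ln ?posrE ?ltr0n ?num_transport_clone_gt0//.
  by rewrite ler_nat num_transport_clone_le.
- move=> k s; rewrite mulr_natl -lnXn ?ltr0n ?num_transport_clone_gt0//.
  rewrite ler_ln ?posrE ?exprn_gt0 ?ltr0n ?num_transport_clone_gt0//.
  by rewrite -natrX ler_nat -mulnn num_transport_clone_mul.
- move=> s; have := num_transport_le_nomial kappa (clone s R) (clone s C).
  rewrite !size_clone !size_tuple sum_clone mulnACA mulnn => le.
  have Z0 := gen_gt0 h0 h1; have hs : 0 < h ^+ (s ^ 2 * sumn R) by rewrite exprn_gt0.
  have Ts : 0 < (T s)%:R :> K by rewrite ltr0n num_transport_clone_gt0.
  have : (T s)%:R * h ^+ (s ^ 2 * sumn R) <= gen kappa h ^+ (s ^ 2 * (m * n)).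
    apply: le_trans (nomial_le_gen _ (s ^ 2 * sumn R) h0 h1).
    by rewrite ler_wpM2r ?ler_nat ?(ltW hs).
  rewrite -ler_ln ?posrE ?mulr_gt0 ?exprn_gt0// lnM ?posrE// !lnXn// -lerBrDr.
  move=> /le_trans; apply; rewrite -(mulr_natl (ln h)) -(mulr_natl (ln (gen _ _))).
  by rewrite !natrM le_eqVlt; apply/predU1P; left; ring.
Qed.

End Transport.

(** * The two exponents and their comparison *)

Section IndependenceComparison.
Variables (K : realType) (kappa : entry_bound) (M : K) (g : K -> K).
Hypotheses (kappa1 : leq_entry_bound 1%N kappa) (gP : entropy_on kappa M g).
Variables (m n N : nat) (R : m.-tuple nat) (C : n.-tuple nat) (Rm Cm : nat).
Hypotheses (RN : sumn R = N) (CN : sumn C = N) (N_gt0 : (0 < N)%N).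
Hypothesis T_gt0 : (0 < num_transport kappa R C)%N.
Hypotheses (R_le : forall i, (tnth R i <= Rm)%N) (C_le : forall j, (tnth C j <= Cm)%N).
Hypothesis small : (Rm * Cm)%:R < M * N%:R.

Lemma sum_tnth k (S : k.-tuple nat) : (\sum_i tnth S i = sumn S)%N.
Proof. by rewrite sumnE big_tuple. Qed.

Lemma sumn_le_max k (S : k.-tuple nat) b : (forall i, tnth S i <= b)%N ->
  (sumn S <= k * b)%N.
Proof.
move=> Sb; rewrite -sum_tnth.
have -> : (k * b = \sum_(i < k) b)%N by rewrite sum_nat_const card_ord.
exact: leq_sum.
Qed.

Let N0 : 0 < N%:R :> K. Proof. by rewrite ltr0n. Qed.

Let m_gt0 : (0 < m)%N.
Proof. by move: N_gt0 (sumn_le_max R_le); rewrite RN; case: m => //; lia. Qed.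

Let n_gt0 : (0 < n)%N.
Proof. by move: N_gt0 (sumn_le_max C_le); rewrite CN; case: n => //; lia. Qed.

(** The common bound [p / q <= Rm * Cm / N < M] behind all four ratios at which [g] is evaluated. *)
Let ratio_lt p q : (0 < q)%N -> (p * N <= Rm * Cm * q)%N -> p%:R / q%:R < M.
Proof.
move=> q0 le; have q0' : 0 < q%:R :> K by rewrite ltr0n.
rewrite ltr_pdivrMr// -(ltr_pM2r N0) mulrAC -natrM.
apply: (@le_lt_trans _ _ (Rm * Cm * q)%:R); first by rewrite ler_nat.
by rewrite natrM ltr_pM2r.
Qed.

Lemma row_ratio i : (tnth R i)%:R / n%:R < M.
Proof.
apply: ratio_lt => //; rewrite -mulnA leq_mul//.
by rewrite -CN mulnC sumn_le_max.
Qed.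

Lemma col_ratio j : (tnth C j)%:R / m%:R < M.
Proof.
apply: ratio_lt => //; rewrite mulnAC mulnC leq_mul//.
by rewrite -RN mulnC sumn_le_max.
Qed.

Lemma mean_ratio : N%:R / (m * n)%:R < M.
Proof.
apply: ratio_lt; first by rewrite muln_gt0 m_gt0.
have -> : (Rm * Cm * (m * n) = (m * Rm) * (n * Cm))%N by lia.
by rewrite leq_mul// -?RN -?CN ?sumn_le_max//; rewrite RN -CN sumn_le_max.
Qed.

Lemma entry_ratio i j : (tnth R i * tnth C j)%:R / N%:R < M.
Proof.
by apply: ratio_lt => //; rewrite leq_mul2r leq_mul ?orbT.
Qed.

Definition indep_exponent : K :=
  n%:R * (\sum_i g ((tnth R i)%:R / n%:R)) +
  m%:R * (\sum_j g ((tnth C j)%:R / m%:R)) - (m * n)%:R * g (N%:R / (m * n)%:R).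

Definition product_exponent : K :=
  \sum_i \sum_j g ((tnth R i * tnth C j)%:R / N%:R).

(** A row or column nomial has length linear in [s] and occurs [s] times, while the total one has
    length quadratic in [s]; so all the logarithms have order [s ^ 2]. *)
Lemma log_indep_cvg : log_indep K kappa R C s @[s --> \oo] --> indep_exponent.
Proof.
rewrite -cvg_shiftS /=.
have mn0 : (0 < m * n)%N by rewrite muln_gt0 m_gt0.
pose A (s : nat) : K := (s.+1%:R ^+ 2)^-1 *
  ln (nomial kappa (s.+1 ^ 2 * (m * n)) (s.+1 ^ 2 * N))%:R.
pose F q p (s : nat) : K := s.+1%:R^-1 * ln (nomial kappa (s.+1 * q) (s.+1 * p))%:R.
have lim : \sum_i F n (tnth R i) s + \sum_j F m (tnth C j) s - A s @[s --> \oo] -->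
    \sum_i n%:R * g ((tnth R i)%:R / n%:R) + \sum_j m%:R * g ((tnth C j)%:R / m%:R) -
    (m * n)%:R * g (N%:R / (m * n)%:R).
  apply: cvgB; last exact: (nomial_cvg_sqr kappa1 gP mn0 mean_ratio).
  apply: cvgD; apply: cvg_sumr => i.
    exact: (nomial_cvg kappa1 gP n_gt0 (row_ratio i)).
  exact: (nomial_cvg kappa1 gP m_gt0 (col_ratio i)).
rewrite /indep_exponent !mulr_sumr; apply: cvg_trans lim; apply: near_eq_cvg.
apply: nearW => s; rewrite /log_indep /indep_estimate.
rewrite !size_clone !size_tuple sum_clone RN.
have -> : (s.+1 * m * (s.+1 * n) = s.+1 ^ 2 * (m * n))%N by rewrite mulnACA mulnn.
have -> : (s.+1 * s.+1 * N = s.+1 ^ 2 * N)%N by rewrite mulnn.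
rewrite (prod_clone _ _ (fun r => (nomial kappa (s.+1 * n) r)%:R : K)).
rewrite (prod_clone _ _ (fun c => (nomial kappa (s.+1 * m) c)%:R : K)).
have s0 : 0 < s.+1%:R :> K by rewrite ltr0n.
have ratioE p q : (s.+1 * p)%:R / (s.+1 * q)%:R = p%:R / q%:R :> K.
  by rewrite !natrM -mulf_div divff ?mul1r// gt_eqF.
have nom_gt0 p q : (0 < q)%N -> p%:R / q%:R < M ->
    0 < (nomial kappa (s.+1 * q) (s.+1 * p))%:R :> K.
  move=> q0 pq; rewrite ltr0n; have := @nomial_entropy_bounds K kappa M g kappa1 gP
    (s.+1 * q) (s.+1 * p); rewrite ratioE muln_gt0 q0 => /(_ isT pq)[].
  by [].
have R_gt0 i : 0 < (nomial kappa (s.+1 * n) (s.+1 * tnth R i))%:R :> K.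
  exact: nom_gt0 (row_ratio i).
have C_gt0 j : 0 < (nomial kappa (s.+1 * m) (s.+1 * tnth C j))%:R :> K.
  exact: nom_gt0 (col_ratio j).
have A_gt0 : 0 < (nomial kappa (s.+1 ^ 2 * (m * n)) (s.+1 ^ 2 * N))%:R :> K.
  have -> : (s.+1 ^ 2 * (m * n) = s.+1 * (s.+1 * (m * n)))%N by rewrite -mulnn -mulnA.
  have -> : (s.+1 ^ 2 * N = s.+1 * (s.+1 * N))%N by rewrite -mulnn -mulnA.
  by apply: nom_gt0; rewrite ?muln_gt0 ?m_gt0 ?n_gt0// ratioE mean_ratio.
rewrite !lnM ?posrE ?mulr_gt0 ?invr_gt0 ?exprn_gt0 ?prodr_gt0//.
rewrite lnV ?posrE// !lnXn ?prodr_gt0// !ln_prodr// /A /F.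
rewrite -!mulr_sumr -!(mulr_natl (\sum_(_ <- _) _) s.+1).
by field; rewrite gt_eqF.
Qed.

Lemma slack_ge0 a s : 0 <= slack K a s.
Proof. by rewrite divr_ge0// ln_ge0// ler1n. Qed.

(** A subsequence of orders suffices, because [l] bounds [log_transport] at every order. *)
Lemma product_exponent_le l : (forall s, log_transport K kappa R C s <= l) ->
  product_exponent <= l.
Proof.
move=> Tl; pose a i j := (odflt 1%N kappa * N ^ 2 + N * (tnth R i * tnth C j))%N.
have lim : \sum_i \sum_j (g ((tnth R i * tnth C j)%:R / N%:R) -
    8 * slack K (a i j).+1 u) @[u --> \oo] --> product_exponent.
  apply: cvg_sumr => i; apply: cvg_sumr => j.
  rewrite -[X in _ --> X]subr0 -[X in _ - X](mulr0 8).
  apply: cvgB; first exact: cvg_cst.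
  by apply: cvgM; [exact: cvg_cst|exact: slack_cvg0].
apply: (cvgr_to_le lim); apply: nearW => u.
set U : K := u.+1%:R; have U1 : 1 <= U by rewrite ler1n.
have N1 : 1 <= N%:R :> K by rewrite ler1n.
(* Making [s.+1] a multiple of [N] turns the block line sums [s.+1 ^ 2 * r_i * c_j / N] into
   integers, the [A i j]. *)
pose s := (N * u.+1).-1; have sE : s.+1 = (N * u.+1)%N.
  by rewrite prednK// muln_gt0 N_gt0.
pose A i j := (N * u.+1 ^ 2 * (tnth R i * tnth C j))%N.
have SE : (s.+1 * s.+1 = u.+1 ^ 2 * N ^ 2)%N by rewrite sE mulnn expnMn mulnC.
have AE i j : A i j = (u.+1 ^ 2 * (N * (tnth R i * tnth C j)))%N.
  by rewrite /A; lia.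
have rA i : (\sum_j A i j = s.+1 * s.+1 * tnth R i)%N.
  rewrite /A -big_distrr -big_distrr /= sum_tnth CN SE; lia.
have cA j : (\sum_i A i j = s.+1 * s.+1 * tnth C j)%N.
  by rewrite /A -big_distrr -big_distrl /= sum_tnth RN SE; lia.
have ratio i j : (A i j)%:R / (s.+1 * s.+1)%:R =
    (tnth R i * tnth C j)%:R / N%:R :> K.
  rewrite AE SE !natrM; field.
  by rewrite -/U !gt_eqF// (lt_le_trans ltr01).
have bnd i j := @nomial_entropy_bounds K kappa M g kappa1 gP (s.+1 * s.+1) (A i j) isT.
have nom0 i j : (0 < nomial kappa (s.+1 * s.+1) (A i j))%N.
  by have := bnd i j; rewrite ratio => /(_ (entry_ratio i j))[].
have := num_transport_clone_ge rA cA nom0.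
set S := (s.+1 * s.+1)%N; set T := num_transport _ _ _ => le.
have T0 : 0 < T%:R :> K by rewrite ltr0n num_transport_clone_gt0.
have SK : S%:R = N%:R ^+ 2 * U ^+ 2 :> K by rewrite /S SE natrM !natrX mulrC.
have S0 : 0 < S%:R :> K by rewrite ltr0n.
have lnT : ln T%:R <= S%:R ^+ 2 * l.
  by rewrite -ler_pdivrMl ?exprn_gt0//; exact: Tl.
have main : \sum_i \sum_j S%:R * ln (nomial kappa S (A i j))%:R <=
    ln (T%:R : K) + \sum_i \sum_j S%:R * (2 * s.+1%:R * ln (A i j).+1%:R).
  have : (\prod_i \prod_j (nomial kappa S (A i j))%:R ^+ S : K) <=
      T%:R * \prod_i \prod_j ((A i j).+1%:R ^+ (s.+1 + s.+1)) ^+ S.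
    under eq_bigr do under eq_bigr do rewrite -natrX.
    under [X in _ <= _ * X]eq_bigr do under eq_bigr do rewrite -!natrX.
    under eq_bigr do rewrite -natr_prod.
    under [X in _ <= _ * X]eq_bigr do rewrite -natr_prod.
    by rewrite -!natr_prod -natrM ler_nat.
  have pn i j : 0 < (nomial kappa S (A i j))%:R ^+ S :> K.
    by rewrite exprn_gt0// ltr0n nom0.
  have pA i j : 0 < ((A i j).+1%:R ^+ (s.+1 + s.+1)) ^+ S :> K.
    by rewrite !exprn_gt0.
  rewrite -ler_ln ?posrE ?mulr_gt0 ?prodr_gt0//; last 2 first.
  - by move=> i _; rewrite prodr_gt0.
  - by move=> i _; rewrite prodr_gt0.
  rewrite lnM ?posrE ?prodr_gt0//; last by move=> i _; rewrite prodr_gt0.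
  rewrite !ln_prodr; last 2 first.
  - by move=> i; rewrite prodr_gt0.
  - by move=> i; rewrite prodr_gt0.
  have -> : \sum_i ln (\prod_j (nomial kappa S (A i j))%:R ^+ S) =
      \sum_i \sum_j S%:R * ln (nomial kappa S (A i j))%:R :> K.
    apply: eq_bigr => i _; rewrite ln_prodr//; apply: eq_bigr => j _.
    by rewrite lnXn ?mulr_natl// ltr0n nom0.
  have -> : \sum_i ln (\prod_j ((A i j).+1%:R ^+ (s.+1 + s.+1)) ^+ S) =
      \sum_i \sum_j S%:R * (2 * s.+1%:R * ln (A i j).+1%:R) :> K.
    apply: eq_bigr => i _; rewrite ln_prodr//; apply: eq_bigr => j _.
    rewrite lnXn ?exprn_gt0// lnXn// [RHS]mulr_natl; congr (_ *+ _).
    by rewrite -(mulr_natl (ln _)) addnn -mul2n natrM.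
  by [].
rewrite -(@ler_pM2l _ (S%:R ^+ 2)) ?exprn_gt0// mulr_sumr.
apply: le_trans lnT; rewrite -lerBlDr -sumrB in main.
apply: le_trans main; apply: ler_sum => i _.
rewrite -sumrB mulr_sumr; apply: ler_sum => j _.
have [_ /andP[lo _]] : (0 < nomial kappa S (A i j))%N /\
    S%:R * g ((A i j)%:R / S%:R) - ln (prefactor kappa S (A i j))%:R
    <= ln (nomial kappa S (A i j))%:R <= S%:R * g ((A i j)%:R / S%:R).
  by apply: bnd; rewrite ratio entry_ratio.
rewrite ratio in lo; set x := g _ in lo *.
have sl0 := slack_ge0 (a i j).+1 u; set sl := slack _ _ _ in sl0 *.
have pf : ln (prefactor kappa S (A i j))%:R <= 4 * U * sl.
  by rewrite /S SE AE; exact: ln_prefactor_slack.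
have lA : ln (A i j).+1%:R <= 2 * U * sl.
  apply: le_trans (ln_sqr_slack K (a i j) u).
  by rewrite ler_ln ?posrE ?ltr0n// ler_nat ltnS AE mulnC leq_mul2r leq_addl orbT.
have sK : s.+1%:R = N%:R * U by rewrite sE natrM.
(* The prefactor costs [4 U sl] and the pigeonhole [4 N U^2 sl]. Each is at most [4 S sl], as
   [S = N^2 U^2]; hence the constant 8. *)
apply: (@le_trans _ _ (S%:R * (S%:R * x - 4 * U * sl - 2 * s.+1%:R * (2 * U * sl)))).
  have -> : S%:R ^+ 2 * (x - 8 * sl) = S%:R * (S%:R * x - 8 * S%:R * sl) by ring.
  rewrite ler_pM2l// -addrA lerD2l -opprD lerN2 sK.
  have -> : 4 * U * sl + 2 * (N%:R * U) * (2 * U * sl) =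
    (4 * U + 4 * N%:R * U ^+ 2) * sl by ring.
  rewrite ler_wpM2r// SK.
  have h1 : N%:R * U ^+ 2 <= N%:R ^+ 2 * U ^+ 2.
    by rewrite ler_wpM2r ?exprn_ge0 ?(le_trans ler01)// ler_eXnr.
  have h2 : U <= N%:R * U ^+ 2.
    rewrite -[X in X <= _]mul1r ler_pM ?(le_trans ler01)//.
    by rewrite ler_eXnr.
  lra.
rewrite -mulrBr ler_pM2l// lerB//.
  by apply: le_trans lo; rewrite lerB.
by rewrite ler_wpM2l// mulr_ge0.
Qed.

(** The two-variable inequality with [a i = r_i / N], mean [1 / m], and [c j = c_j], mean [N / n]:
    the products of entries and means are exactly the arguments of [g] in the two exponents. *)
Lemma indep_le_product : indep_exponent <= product_exponent
  ?= iff [forall i, ((tnth R i)%:R / N%:R == m%:R^-1 :> K) ||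
           [forall j, (tnth C j)%:R == N%:R / n%:R :> K]].
Proof.
have m0 : 0 < m%:R :> K by rewrite ltr0n m_gt0.
have n0 : 0 < n%:R :> K by rewrite ltr0n n_gt0.
have e1 i : (tnth R i)%:R / N%:R * (N%:R / n%:R) = (tnth R i)%:R / n%:R :> K.
  by rewrite mulrA divfK// gt_eqF.
have e2 j : m%:R^-1 * (tnth C j)%:R = (tnth C j)%:R / m%:R :> K by rewrite mulrC.
have e3 : m%:R^-1 * (N%:R / n%:R) = N%:R / (m * n)%:R :> K.
  by rewrite natrM; field; rewrite !gt_eqF.
have e4 i j : (tnth R i)%:R / N%:R * (tnth C j)%:R =
    (tnth R i * tnth C j)%:R / N%:R :> K.
  by rewrite natrM mulrAC.
have sumR : \sum_i (tnth R i)%:R / N%:R = m%:R * m%:R^-1 :> K.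
  by rewrite -mulr_suml -natr_sum sum_tnth RN !divff ?gt_eqF.
have sumC : \sum_j (tnth C j)%:R = n%:R * (N%:R / n%:R) :> K.
  by rewrite -natr_sum sum_tnth CN mulrC divfK// gt_eqF.
have := @entropy_on_jensen _ _ _ _ gP m n (fun i => (tnth R i)%:R / N%:R)
  (fun j => (tnth C j)%:R) m%:R^-1 (N%:R / n%:R) _ _ _ _ sumR sumC.
have E1 : \sum_i g ((tnth R i)%:R / N%:R * (N%:R / n%:R)) =
    \sum_i g ((tnth R i)%:R / n%:R).
  by apply: eq_bigr => i _; rewrite e1.
have E2 : \sum_j g (m%:R^-1 * (tnth C j)%:R) = \sum_j g ((tnth C j)%:R / m%:R).
  by apply: eq_bigr => j _; rewrite e2.
have E4 : \sum_i \sum_j g ((tnth R i)%:R / N%:R * (tnth C j)%:R) = product_exponent.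
  by apply: eq_bigr => i _; apply: eq_bigr => j _; rewrite e4.
rewrite /= E1 E2 E4 e3; apply=> //.
- by rewrite invr_gt0.
- by rewrite divr_gt0.
- by move=> i j; rewrite e4 entry_ratio.
- by move=> i; rewrite e1 row_ratio.
- by move=> j; rewrite e2 col_ratio.
- exact: mean_ratio.
Qed.

Lemma constant_tnth k (S : k.-tuple nat) (x : K) :
  (forall i, (tnth S i)%:R = x) -> constant S.
Proof.
move=> Sx; case SE : (tval S) => [//|y l] /=; apply/allP => z zl.
have /tnthP[i yi] : y \in S by rewrite memtE SE mem_head.
have /tnthP[j zj] : z \in S by rewrite memtE SE inE zl orbT.
by rewrite /= -(eqr_nat K) yi zj !Sx.
Qed.

Lemma compare_limits :
  [/\ cvgn (log_transport K kappa R C),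
      cvgn (log_indep K kappa R C),
      limn (log_indep K kappa R C) <= limn (log_transport K kappa R C) &
      ~~ constant R -> ~~ constant C ->
      limn (log_indep K kappa R C) < limn (log_transport K kappa R C)].
Proof.
have [l Tl Tle] := log_transport_cvg K T_gt0.
have Il := log_indep_cvg.
have pl := product_exponent_le Tle; have [le eq] := indep_le_product.
have limT : limn (log_transport K kappa R C) = l by apply: cvg_lim.
have limI : limn (log_indep K kappa R C) = indep_exponent by apply: cvg_lim.
split; [by apply/cvg_ex; exists l|by apply/cvg_ex; exists indep_exponent| |].
  by rewrite limT limI (le_trans le).
move=> Rc Cc; rewrite limT limI; apply: lt_le_trans pl.
rewrite lt_neqAle le andbT eq; apply: contra Rc => /forallP RC.
apply: (@constant_tnth _ _ (N%:R / m%:R)) => i.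
case/orP: (RC i) => [/eqP E|/forallP CE].
  by rewrite -E [RHS]mulrC divfK// gt_eqF.
case/negP: Cc; apply: (@constant_tnth _ _ (N%:R / n%:R)) => j.
by apply/eqP; exact: CE.
Qed.

End IndependenceComparison.

(** With unbounded entries the infinite threshold admits [N = 0], where the main comparison would
    divide by 0. All nomials are then 1, and [R] is constant, so the strict part is vacuous. *)
Lemma compare_limits0 (K : realType) (kappa : entry_bound) m n
    (R : m.-tuple nat) (C : n.-tuple nat) :
  sumn R = 0%N -> sumn C = 0%N -> (0 < num_transport kappa R C)%N ->
  [/\ cvgn (log_transport K kappa R C),
      cvgn (log_indep K kappa R C),
      limn (log_indep K kappa R C) <= limn (log_transport K kappa R C) &
      ~~ constant R -> ~~ constant C ->
      limn (log_indep K kappa R C) < limn (log_transport K kappa R C)].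
Proof.
move=> R0 C0 T_gt0; have [l Tl Tle] := log_transport_cvg K T_gt0.
have z k (S : k.-tuple nat) i : sumn S = 0%N -> tnth S i = 0%N.
  by move=> S0; have := tnth_le_sumn S i; rewrite S0 leqn0 => /eqP.
have prod1 k (S : k.-tuple nat) (q s : nat) : sumn S = 0%N ->
    \prod_i (nomial kappa q (s * tnth S i))%:R = 1 :> K.
  by move=> S0; rewrite big1// => i _; rewrite z// muln0 nomial_r0.
have I0 s : log_indep K kappa R C s = 0.
  rewrite /log_indep /indep_estimate sum_clone R0 muln0 nomial_r0 invr1 mul1r.
  rewrite (prod_clone _ _ (fun r => (nomial kappa (size (clone s C)) r)%:R : K)).
  rewrite (prod_clone _ _ (fun c => (nomial kappa (size (clone s R)) c)%:R : K)).
  by rewrite !prod1// !expr1n mulr1 ln1 mulr0.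
have Il : log_indep K kappa R C s @[s --> \oo] --> (0 : K).
  have -> : log_indep K kappa R C = cst 0 by apply/funext; exact: I0.
  exact: cvg_cst.
have limT : limn (log_transport K kappa R C) = l by apply: cvg_lim.
have limI : limn (log_indep K kappa R C) = 0 by apply: cvg_lim.
split; [by apply/cvg_ex; exists l|by apply/cvg_ex; exists 0| |].
  by rewrite limT limI; have := Tle 0%N; rewrite /log_transport expr0n /= invr0 mul0r.
move=> /negP[]; apply: (@constant_tnth K _ _ 0) => i; by rewrite z.
Qed.

Unset Implicit Arguments.
Set Strict Implicit.
Set Printing Implicit Defensive.

Theorem theorem4 (K : realType) (kappa : entry_bound)
    (hkappa : leq_entry_bound 2%N kappa) :
  exists delta : K, [/\ 0 < delta, delta < 1 &
    forall (m n N : nat) (R : m.-tuple nat) (C : n.-tuple nat),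
      sumn R = N -> sumn C = N ->
      (0 < num_transport kappa R C)%N ->
      (((\max_(r <- R) r) * (\max_(c <- C) c))%N%:R%:E
         < sparsity_threshold delta kappa N)%E ->
      [/\ cvgn (log_transport K kappa R C),
          cvgn (log_indep K kappa R C),
          limn (log_indep K kappa R C) <= limn (log_transport K kappa R C) &
          ~~ constant R -> ~~ constant C ->
          limn (log_indep K kappa R C) < limn (log_transport K kappa R C)]].
Proof.
have kappa1 : leq_entry_bound 1%N kappa.
  by case: kappa hkappa => //= k; exact: ltnW.
have le_max k (S : k.-tuple nat) i : (tnth S i <= \max_(x <- S) x)%N.
  by rewrite big_tuple; exact: (leq_bigmax i).
have half1 : 2^-1 < 1 :> K by rewrite invf_lt1// ltr1n.
case: kappa hkappa kappa1 => [k|] hkappa kappa1; last first.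
  (* The threshold is infinite whatever [delta] is, and the interval for [g] may be chosen after the
     margins. *)
  exists 2^-1; split=> // m n N R C RN CN T0 _.
  case: (posnP N) => [N0|N0].
    by apply: compare_limits0; rewrite ?RN ?CN.
  pose Rm := \max_(r <- R) r; pose Cm := \max_(c <- C) c.
  have [g gP] := entropy_on_oo ((Rm * Cm).+1%:R : K).
  apply: (compare_limits kappa1 gP RN CN N0 T0 (le_max _ R) (le_max _ C)).
  by rewrite -natrM ltr_nat leq_pmulr.
have [M M0 [g gP]] := @entropy_on_fin K k hkappa.
have k0 : 0 < k%:R :> K by rewrite ltr0n (ltn_trans _ hkappa).
(* The second term gives [delta * k * N <= M * N], the first [delta < 1]. *)
exists (Num.min 2^-1 (M / k%:R)); split; first by rewrite lt_min invr_gt0 divr_gt0// ltr0n.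
  by rewrite (le_lt_trans _ half1)// ge_min lexx.
move=> m n N R C RN CN T0; rewrite /= lte_fin => small.
have N0 : (0 < N)%N.
  by case: (posnP N) small => // ->; rewrite mulr0 ltrn0.
apply: (compare_limits kappa1 gP RN CN N0 T0 (le_max _ R) (le_max _ C)).
apply: lt_le_trans small _; rewrite ler_wpM2r// -ler_pdivlMr//.
by rewrite ge_min lexx orbT.
Qed.
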